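(* Let $\xi\approx 1.678$ be the unique real root of $2x^3-3x^2-1$. The scheduler $\mathsf{eve}$ is a $\xi$-competitive eventually-committing scheduler for the One-Fast-Many-Slow Decision Problem.
   Context: One-Fast-Many-Slow Decision Problem: there is a single fast machine and an unlimited number of slow machines. An instance is a task arrival process (TAP) $\mathcal{T}=(\tau_1,\dots,\tau_n)$, where $\tau_i=(\sigma_i,\pi_i,t_i)$ gives the task's runtime $\sigma_i$ on a slow machine, its runtime $\pi_i$ on the fast machine, and its arrival time $t_i$, with $t_1\le\dots\le t_n$. A valid schedule assigns at most one task to each machine at each time, does no work on a task before its arrival time, runs each task on at most one machine, and runs each task $\tau_i$ either for a total of $\sigma_i$ time on some slow machine or for a total of $\pi_i$ time on the fast machine. The completion time is the time when the last task finishes. An online scheduler learns each task only at its arrival time and at each time $t$ must already have fixed the schedule before $t$. An eventually-committing scheduler need not fix a machine for a task until that task begins running, but once a task starts on a machine this choice is irrevocable. A scheduler is $c$-competitive if on every TAP its completion time is at most $c$ times the minimum completion time of an offline valid schedule for that TAP. For $t\ge0$, $\mathcal{T}^t$ is the truncation of $\mathcal{T}$ to tasks with $t_i\le t$, and $C^t$ is the minimum completion time of any valid offline schedule for $\mathcal{T}^t$. The scheduler $\mathsf{eve}$ acts as follows at each time $t$: (1) if a task $\tau_i$ that has arrived but not yet been started satisfies $\sigma_i+t\le \xi C^t$, start $\tau_i$ on a slow machine; (2) it maintains at most one active task at a time, and the fast machine is always allocated to the active task (until it completes); (3) when there is no active task but there are unstarted tasks present, it chooses as the new active task the unstarted task with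 the largest value of $\sigma_i+t_i$ (ties broken arbitrarily). *)

(* Defs.v *)
From mathcomp Require Import all_boot all_order all_algebra.
From mathcomp Require Import all_classical all_reals all_analysis.

Set Implicit Arguments.
Unset Strict Implicit.
Unset Printing Implicit Defensive.

Import Order.TTheory GRing.Theory Num.Theory.

Local Open Scope classical_set_scope.
Local Open Scope ring_scope.

(* sigma, pi and t of a task, respectively. *)
Record task (R : realType) := Task {
  slow_time : R;
  fast_time : R;
  arrival : R }.

Inductive machine := Fast | Slow of nat.

Definition runtime (R : realType) (m : machine) (x : task R) : R :=
  if m is Fast then fast_time x else slow_time x.

Definition task_at (R : realType) (T : seq (task R)) (i : nat) : task R :=
  nth (Task 0 0 0) T i.

Definition is_tap (R : realType) (T : seq (task R)) : Prop :=
  sorted (fun x y : task R => arrival x <= arrival y) T /\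
  forall i, (i < size T)%N ->
    let x := task_at T i in
    [/\ 0 < slow_time x, 0 < fast_time x & 0 <= arrival x].

(* For a sorted T this is a prefix of T, so a task has the same index in T
   and in all the truncations of T that contain it. *)
Definition trunc (R : realType) (t : R) (T : seq (task R)) : seq (task R) :=
  [seq x <- T | arrival x <= t].

(* S m t = Some i: machine m works on the i-th task at time t.  That a machine
   works on at most one task at a time is built into the type. *)
Definition schedule (R : realType) := machine -> R -> option nat.

Definition runs (R : realType) (S : schedule R) (m : machine) (i : nat) :
  set R := [set t | S m t = Some i].

(* Interruptions are allowed, only the total running time is prescribed. *)
Definition valid_schedule (R : realType) (T : seq (task R)) (S : schedule R) :
    Prop :=
  [/\ forall m i, measurable (runs S m i),
      forall m i t, runs S m i t ->
        (i < size T)%N /\ arrival (task_at T i) <= t,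
      forall i m m' t t', runs S m i t -> runs S m' i t' -> m = m' &
      forall i, (i < size T)%N ->
        exists m, lebesgue_measure (runs S m i)
                  = (runtime m (task_at T i))%:E].

Definition finished_by (R : realType) (T : seq (task R)) (S : schedule R)
    (c : R) : Prop :=
  forall i, (i < size T)%N ->
    exists m, lebesgue_measure (runs S m i `&` [set t | t <= c])
              = (runtime m (task_at T i))%:E.

(* It is 0 if T is empty, and +oo if the work is never finished. *)
Definition completion (R : realType) (T : seq (task R)) (S : schedule R) :
    \bar R :=
  ereal_inf [set c%:E | c in [set c : R | 0 <= c /\ finished_by T S c]].

(* The infimum is a minimum: a valid schedule can be replaced, without delaying
   its completion, by one that starts the tasks on slow machines upon arrival
   and runs the tasks of the fast machine without interruption in order of
   arrival, and the completions of such schedules form a finite set. *)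
Definition opt (R : realType) (T : seq (task R)) : \bar R :=
  ereal_inf [set completion T S | S in [set S | valid_schedule T S]].

Definition scheduler (R : realType) := seq (task R) -> schedule R.

Definition online (R : realType) (f : scheduler R) : Prop :=
  forall T T' t, is_tap T -> is_tap T' -> trunc t T = trunc t T' ->
  forall m s, s <= t -> f T m s = f T' m s.

Definition eventually_committing (R : realType) (f : scheduler R) : Prop :=
  [/\ forall T, is_tap T -> valid_schedule T (f T),
      online f &
      (* a task started by time t stays on its machine in every continuation *)
      forall T T' t, is_tap T -> is_tap T' -> trunc t T = trunc t T' ->
      forall i m s, s <= t -> runs (f T) m i s ->
      forall m' s', runs (f T') m' i s' -> m' = m].

Definition competitive (R : realType) (c : R) (f : scheduler R) : Prop :=
  forall T, is_tap T -> (completion T (f T) <= c%:E * opt T)%E.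

Section Eve.
Context (R : realType) (xi : R).

(* Which of the tasks in a set of indices becomes active, given the tasks that
   have arrived and the current time.  The history is not an argument: being
   determined by the arrived tasks and the rule, it adds no generality. *)
Definition tie_rule := seq (task R) -> R -> set nat -> nat.

Definition is_tie_rule (tb : tie_rule) : Prop :=
  forall T t A, A !=set0 -> A (tb T t A).

Implicit Types (T : seq (task R)) (S : schedule R).

Definition starts S (m : machine) (i : nat) (t : R) : Prop :=
  runs S m i t /\ forall m' s, s < t -> ~ runs S m' i s.

Definition pending T S (t : R) (i : nat) : Prop :=
  [/\ (i < size T)%N, arrival (task_at T i) <= t &
      forall m s, s < t -> ~ runs S m i s].

Definition slow_ok T (t : R) (i : nat) : Prop :=
  ((slow_time (task_at T i) + t)%:E <= xi%:E * opt (trunc t T))%E.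

(* The tasks still unstarted once the slow starts of time t have been made. *)
Definition waiting T S (t : R) (i : nat) : Prop :=
  pending T S t i /\ ~ slow_ok T t i.

Definition candidates T S (t : R) : set nat :=
  [set i | waiting T S t i /\
     forall j, waiting T S t j ->
       slow_time (task_at T j) + arrival (task_at T j)
       <= slow_time (task_at T i) + arrival (task_at T i)].

(* i became active before t and has not completed at t. *)
Definition still_active T S (t : R) (i : nat) : Prop :=
  exists s, [/\ starts S Fast i s, s < t & t < s + fast_time (task_at T i)].

(* The slow machines are identical and unlimited in number, so the i-th one is
   reserved for the i-th task. *)
Definition eve_schedule (tb : tie_rule) T S : Prop :=
  [/\ (* a started task runs without interruption until it completes *)
      forall m i t, runs S m i t <->
        exists2 s, starts S m i s & s <= t < s + runtime m (task_at T i),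
      forall k i t, starts S (Slow k) i t <->
        [/\ k = i, pending T S t i & slow_ok T t i] &
      forall i t, starts S Fast i t <->
        [/\ forall j, ~ still_active T S t j,
            candidates T S t !=set0 &
            i = tb (trunc t T) t (candidates T S t)]].

Definition is_eve (tb : tie_rule) (f : scheduler R) : Prop :=
  forall T, is_tap T -> eve_schedule tb T (f T).

End Eve.

(* Main.v *)
(* Write C^t for the optimum of the tasks arrived by time t, C for the final optimum and
   q = sigma + t for the earliest slow completion of a task.  A task that eve runs on the
   fast machine was never eligible for a slow start, so pi + t <= C^t < q / xi at its
   arrival, and any set of tasks with q > C^t must be run by the fast machine in every
   near-optimal schedule of the tasks arrived by t, which bounds their total fast time.

   Suppose a task l completes on the fast machine at F > xi C.  If q_l > C, going back
   from l to the last task x started with q_x <= C, everything after x arrived after x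
   started and must run fast, so F <= C + pi_x <= (1 + 1/xi) C.  Otherwise l starts after
   C; go back to the last task x with q_x < q_l.  Let D be the optimum at the last arrival
   t* of a task run after x that satisfies q <= C; then D < C / xi, and every task arriving
   later must run fast.
   - If q_l <= D, induction bounds the fast work left at t* by xi D - t*, and l not being
     eligible at t* gives F <= xi D + C - t* < C + D.
   - If q_l > D and q_x > D (or there is no x), all the fast work is forced and F <= C + D.
   - Otherwise pi_x <= C / xi^2.  At the first time th with C^th >= q_l, the fast work that
     arrived before th is at most q_l, the later one at most C - th, and th > xi q_l - q_l,
     so F < C / xi^2 + (3 - xi) C = xi C, which is the equation defining xi. *)
Require Import Defs.
From mathcomp Require Import all_boot all_order all_algebra.
From mathcomp Require Import all_classical all_reals all_analysis.
From mathcomp Require Import ring lra.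

Set Implicit Arguments.
Unset Strict Implicit.
Unset Printing Implicit Defensive.

Import Order.TTheory GRing.Theory Num.Theory.

Local Open Scope classical_set_scope.
Local Open Scope ring_scope.

(** * The cubic and its real root *)

Section Root.
Variable R : realType.

Let p : {poly R} := 2%:P * 'X^3 - 3%:P * 'X^2 - 1.

Lemma horner_pE (x : R) : p.[x] = 2 * x ^+ 3 - 3 * x ^+ 2 - 1.
Proof. by rewrite /p !hornerE; ring. Qed.

Lemma root_pE (x : R) : root p x -> 2 * x ^+ 3 - 3 * x ^+ 2 = 1.
Proof. by rewrite /root horner_pE subr_eq0 => /eqP. Qed.

Lemma root_gt (x : R) : 2 * x ^+ 3 - 3 * x ^+ 2 = 1 -> 3 / 2 < x.
Proof.
move=> h; have h2 : x ^+ 2 * (2 * x - 3) = 1 by rewrite -[RHS]h; ring.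
rewrite ltNge; apply/negP => le_x.
have : x ^+ 2 * (2 * x - 3) <= 0 by rewrite mulr_ge0_le0 ?sqr_ge0//; lra.
by rewrite h2 ler10.
Qed.

Lemma root_uniq (x y : R) : 2 * x ^+ 3 - 3 * x ^+ 2 = 1 ->
  2 * y ^+ 3 - 3 * y ^+ 2 = 1 -> x = y.
Proof.
move=> hx hy; have gx := root_gt hx; have gy := root_gt hy.
have : (x - y) * (2 * (x ^+ 2 + x * y + y ^+ 2) - 3 * (x + y)) = 0.
  transitivity ((2 * x ^+ 3 - 3 * x ^+ 2) - (2 * y ^+ 3 - 3 * y ^+ 2)); first by ring.
  by rewrite hx hy subrr.
move=> /eqP; rewrite mulf_eq0 => /orP[|]; first by rewrite subr_eq0 => /eqP.
have -> : 2 * (x ^+ 2 + x * y + y ^+ 2) - 3 * (x + y) =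
  2 * (x * (x - 3 / 2) + y * (y - 3 / 2) + x * y) by field.
by rewrite gt_eqF// mulr_gt0// !addr_gt0// mulr_gt0//; lra.
Qed.

(** The cubic changes sign between these endpoints, and both lie within 1/2000 of 1.678. *)
Lemma exists_root : exists2 xi : R, root p xi & 255 / 152 <= xi <= 151 / 90.
Proof.
have [||xi] := @poly_ivt R p (255 / 152) (151 / 90); first by lra.
  by rewrite !horner_pE; apply/andP; split; lra.
by exists xi.
Qed.

(** The form in which the competitive analysis uses the equation: its critical case needs x^-2 + (3
    - x) = x. *)
Lemma root_inv_sqr (x : R) : 2 * x ^+ 3 - 3 * x ^+ 2 = 1 ->
  x^-1 * x^-1 = 2 * x - 3.
Proof.
move=> h; have gx := root_gt h; have x0 : x != 0 by rewrite gt_eqF//; lra.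
apply: (mulfI (expf_neq0 2 x0)); rewrite (_ : x ^+ 2 * (2 * x - 3) = 1).
  by field.
by rewrite -[RHS]h; ring.
Qed.

End Root.

(** * Extrema over finite lists, covering and packing of intervals *)

Section Finite.
Variable R : realType.

Lemma ex_argmin (I : eqType) (s : seq I) (f : I -> R) (P : I -> Prop) :
  (exists2 i, i \in s & P i) ->
  exists i, [/\ i \in s, P i & forall j, j \in s -> P j -> f i <= f j].
Proof.
elim: s => [[i]//|x s IH hx]; have [Ps|nPs] := pselect (exists2 i, i \in s & P i).
  have [i [si Pi mi]] := IH Ps; have [Px|nPx] := pselect (P x).
    have [le_xi|/ltW le_ix] := leP (f x) (f i).
      exists x; split=> // [|j]; first by rewrite mem_head.
      rewrite inE => /predU1P[->//|sj Pj].
      exact: le_trans le_xi (mi _ sj Pj).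
    exists i; split=> // [|j]; first by rewrite inE si orbT.
    by rewrite inE => /predU1P[->//|]; exact: mi.
  exists i; split=> // [|j]; first by rewrite inE si orbT.
  by rewrite inE => /predU1P[->//|]; exact: mi.
case: hx => i; rewrite inE => /predU1P[-> Px|si Pi]; last by case: nPs; exists i.
exists x; split=> // [|j]; first by rewrite mem_head.
by rewrite inE => /predU1P[->//|sj Pj]; case: nPs; exists j.
Qed.

Lemma ex_argmax (I : eqType) (s : seq I) (f : I -> R) (P : I -> Prop) :
  (exists2 i, i \in s & P i) ->
  exists i, [/\ i \in s, P i & forall j, j \in s -> P j -> f j <= f i].
Proof.
move=> /(@ex_argmin I s (fun i => - f i)) [i [si Pi mi]].
by exists i; split=> // j sj Pj; rewrite -lerN2; exact: mi.
Qed.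

Lemma ex_ubound n (f : nat -> R) :
  exists2 c, 0 <= c & forall i, (i < n)%N -> f i <= c.
Proof.
elim: n => [|n [c c0 le_c]]; first by exists 0.
exists (Num.max c (f n)) => [|i]; first by rewrite le_max c0.
rewrite ltnS leq_eqVlt le_max => /predU1P[->|/le_c->//].
by rewrite lexx orbT.
Qed.

(** Greedy argument: the interval containing [a] is removed and its right end becomes the new left
    end, beyond which the other intervals still cover. *)
Lemma cover_le_sum (A : seq nat) (l r : nat -> R) (a b : R) :
  (forall i, i \in A -> l i <= r i) ->
  (forall u, a <= u < b -> exists2 i, i \in A & l i <= u < r i) ->
  b <= a + \sum_(i <- A) (r i - l i).
Proof.
elim: {A}(size A) {-2}A (leqnn (size A)) a => [|n IH] A leA a lr cov.
  move: leA; rewrite leqn0 => /nilP A0; rewrite A0 big_nil addr0 leNgt.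
  by apply/negP => ltab; case: (cov a); rewrite ?lexx// A0.
have [le_ba|lt_ab] := leP b a.
  apply: le_trans le_ba _; rewrite lerDl big_seq sumr_ge0// => i Ai.
  by rewrite subr_ge0 lr.
have [|i Ai /andP[lia ari]] := cov a; first by rewrite lexx.
rewrite (big_rem i)//=; apply: le_trans (IH (rem i A) _ (r i) _ _) _.
- by rewrite size_rem//; case: (size A) leA.
- by move=> j /mem_rem; exact: lr.
- move=> u /andP[riu ub]; have [|j Aj /andP[lju urj]] := cov u.
    by rewrite ub (le_trans (ltW ari)).
  exists j; last by rewrite lju.
  apply: rem_mem Aj; apply/eqP => ji; move: urj; rewrite ji => /lt_le_trans.
  by move=> /(_ _ riu); rewrite ltxx.
- lra.
Qed.

Local Notation mu := (@lebesgue_measure R).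

(* [lebesgue_measure] lives on [measurableTypeR R], which is only convertible to
   the measurable structure of R; the casts of the next two lemmas bridge it. *)
Lemma le_mu (A B : set R) : measurable A -> measurable B -> A `<=` B ->
  (mu A <= mu B)%E.
Proof.
move=> mA mB AB; pose m : {measure set (measurableTypeR R) -> \bar R} := mu.
have h := @le_measure _ R (measurableTypeR R) m A B.
by apply: (h _ _ AB); exact: mem_set.
Qed.

Lemma muU (A B : set R) : measurable A -> measurable B -> A `&` B = set0 ->
  mu (A `|` B) = (mu A + mu B)%E.
Proof.
move=> mA mB; pose m : {measure set (measurableTypeR R) -> \bar R} := mu.
exact: (@measureU _ R (measurableTypeR R) m A B mA mB).
Qed.

(** The dual of [cover_le_sum]: it bounds from above the work that one machine can do in
    [[a, b]]. *)
Lemma packing (A : seq nat) (E : nat -> set R) (a b : R) :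
  uniq A -> a <= b ->
  (forall i, i \in A -> measurable (E i) /\ E i `<=` `[a, b]) ->
  (forall i j t, i \in A -> j \in A -> E i t -> E j t -> i = j) ->
  (\sum_(i <- A) mu (E i) <= (b - a)%:E)%E.
Proof.
move=> uA leab mE dE; set U := \big[setU/set0]_(i <- A) E i.
have [mU subU ->] : [/\ measurable U, U `<=` \bigcup_(i in [set` A]) E i &
    (\sum_(i <- A) mu (E i))%E = mu U].
  rewrite {}/U; elim: A uA mE dE => [|i A IH] /=.
    by move=> _ _ _; rewrite !big_nil measure0; split.
  move=> /andP[iA uA] mE dE.
  have [||mU subU eU] := IH uA.
  - by move=> j jA; apply: mE; rewrite inE jA orbT.
  - by move=> j k t jA kA; apply: dE; rewrite inE ?jA ?kA orbT.
  have [mi _] := mE i (mem_head _ _).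
  rewrite !big_cons; split; first exact: measurableU.
    move=> t [Et|/subU[j jA Et]]; first by exists i => //=; rewrite mem_head.
    by exists j => //=; rewrite inE [j \in A]jA orbT.
  rewrite muU// ?eU//; apply/seteqP; split=> // t [Eit /subU[j jA Ejt]].
  move: iA; rewrite (dE i j t)//= ?mem_head// ?[j \in A]jA//.
  by rewrite inE [j \in A]jA orbT.
have mab : measurable (`[a, b]%classic : set R) by exact: measurable_itv.
have subab : U `<=` `[a, b] by move=> t /subU[i /mE[_]]; exact.
apply: le_trans (le_mu mU mab subab) _.
by rewrite lebesgue_measure_itv /= lte_fin; case: ltP => //; rewrite lee_fin subr_ge0.
Qed.

Lemma lebesgue_measure_co (a b : R) : a <= b -> mu `[a, b[ = (b - a)%:E.
Proof.
rewrite lebesgue_measure_itv /= lte_fin le_eqVlt => /predU1P[->|-> //].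
by rewrite ltxx subrr.
Qed.

End Finite.

(** * Truncations as prefixes of the instance *)

Section Trunc.
Variable R : realType.
Implicit Types (T : seq (task R)).

Lemma ex_max_candidate T (W : nat -> Prop) i :
  (forall j, W j -> (j < size T)%N) -> W i ->
  exists j, W j /\ forall k, W k ->
    slow_time (task_at T k) + arrival (task_at T k)
    <= slow_time (task_at T j) + arrival (task_at T j).
Proof.
move=> WT Wi; have [|j [_ Wj mj]] := @ex_argmax R nat (iota 0 (size T))
    (fun j => slow_time (task_at T j) + arrival (task_at T j)) W.
  by exists i; rewrite // mem_iota WT.
by exists j; split=> // k Wk; apply: mj => //; rewrite mem_iota WT.
Qed.

Lemma trunc_late t x T : is_tap (x :: T) -> ~~ (arrival x <= t) ->
  all (fun y => ~~ (arrival y <= t)) (x :: T).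
Proof.
move=> [+ _] xt /=; rewrite xt /=.
have tr : transitive (fun x y : task R => arrival x <= arrival y).
  by move=> a b c; apply: le_trans.
move=> /(order_path_min tr); apply: sub_all => y xy.
by apply: contra xt; exact: le_trans.
Qed.

Lemma runtime_gt0 T m i : is_tap T -> (i < size T)%N -> 0 < runtime m (task_at T i).
Proof. by case=> _ h /h[s0 f0 _]; case: m. Qed.

Lemma tap_behead x T : is_tap (x :: T) -> is_tap T.
Proof. by case=> /path_sorted sT h; split=> // i iT; exact: h i.+1 iT. Qed.

Lemma truncE t T : is_tap T -> trunc t T = take (size (trunc t T)) T.
Proof.
rewrite /trunc; elim: T => //= x T IH tT.
case: ifPn => [_|/(trunc_late tT)/andP[_ aT]] /=.
  by rewrite -IH//; exact: tap_behead tT.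
rewrite (_ : [seq y <- T | arrival y <= t] = [::]) ?take0//.
by apply: size0nil; rewrite size_filter; apply/eqP; rewrite -leqn0 leqNgt
  -has_count -all_predC.
Qed.

Lemma lt_size_trunc t T i : is_tap T ->
  (i < size (trunc t T))%N = (i < size T)%N && (arrival (task_at T i) <= t).
Proof.
rewrite /trunc /task_at; elim: T i => [|x T IH] i tT /=; first by rewrite ltn0.
case: ifPn => xt; first by case: i => [|i] //=; rewrite ltnS IH//; exact: tap_behead tT.
have /(all_nthP (Task 0 0 0)) h := trunc_late tT xt.
transitivity false.
  rewrite ltnNge size_filter; apply/negbTE; rewrite negbK.
  have := trunc_late tT xt; rewrite -[all _ _]/(all (predC _) _) all_predC has_count.
  by rewrite -leqNgt /= (negbTE xt) add0n => /leq_trans; apply.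
by apply/esym/negbTE; rewrite negb_and -implybE; apply/implyP => /h.
Qed.

Lemma task_at_trunc t T i : is_tap T -> (i < size (trunc t T))%N ->
  task_at (trunc t T) i = task_at T i.
Proof. by move=> tT it; rewrite /task_at [in LHS](truncE t tT) nth_take. Qed.

Lemma tap_trunc t T : is_tap T -> is_tap (trunc t T).
Proof.
move=> tT; split.
  rewrite (truncE t tT).
  by case: tT => sT _; exact: take_sorted.
move=> i iT; rewrite task_at_trunc//; case: tT (tT) => _ h tT; apply: h.
by move: iT; rewrite lt_size_trunc// => /andP[].
Qed.

Lemma trunc_id t T : is_tap T ->
  (forall i, (i < size T)%N -> arrival (task_at T i) <= t) -> trunc t T = T.
Proof.
move=> tT h; rewrite truncE//; apply: take_oversize; rewrite leqNgt.
by apply/negP => ht; move: (h _ ht) (ltnn (size (trunc t T))); rewrite lt_size_trunc// ht => ->.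
Qed.

Lemma trunc_trunc u t T : u <= t -> trunc u (trunc t T) = trunc u T.
Proof.
move=> ut; rewrite /trunc -filter_predI; apply: eq_filter => x /=.
by apply: andb_idr => /le_trans; apply.
Qed.

End Trunc.

(** * The offline optimum *)

Section Opt.
Variable R : realType.
Implicit Types (T : seq (task R)) (S : schedule R).
Local Notation mu := (@lebesgue_measure R).

Definition copt T : R := fine (opt T).

Lemma completion_ge0 T S : (0 <= completion T S)%E.
Proof. by apply/ereal_infP => _ [c [c0 _]] <-; rewrite lee_fin. Qed.

Lemma completion_le T S c : 0 <= c -> finished_by T S c ->
  (completion T S <= c%:E)%E.
Proof. by move=> c0 fc; apply: ge_ereal_inf; exists c%:E => //; exists c. Qed.

Lemma opt_ge0 T : (0 <= opt T)%E.
Proof. by apply/ereal_infP => _ [S _] <-; exact: completion_ge0. Qed.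

(** A valid schedule that always exists; its completion time shows that the optimum is finite. *)
Definition slow_schedule T : schedule R := fun m t =>
  if m is Slow k then
    if (k < size T)%N &&
       (arrival (task_at T k) <= t < arrival (task_at T k) + slow_time (task_at T k))
    then Some k else None
  else None.

Lemma runs_slow_schedule T m i : runs (slow_schedule T) m i =
  if m is Slow k then
    if (k == i) && (i < size T)%N then
      `[arrival (task_at T i), arrival (task_at T i) + slow_time (task_at T i)[%classic
    else set0
  else set0.
Proof.
apply/seteqP; rewrite /runs /slow_schedule; case: m => [|k] /=; first by split.
case: ifPn => [/andP[/eqP-> iT]|].
  rewrite iT /=; split=> t /=; first by case: ifPn => // + _; rewrite in_itv.
  by rewrite in_itv /= => ->.
move=> nki; split=> // t /=; case: ifPn => // /andP[kT _] [ki].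
by move: nki; rewrite -ki kT eqxx.
Qed.

Lemma slow_schedule_valid T : is_tap T -> valid_schedule T (slow_schedule T).
Proof.
move=> [_ hT]; split.
- by move=> m i; rewrite runs_slow_schedule; case: m => // k; case: ifPn.
- move=> m i t; rewrite runs_slow_schedule; case: m => // k; case: ifPn => //.
  by case/andP => _ iT /=; rewrite in_itv /= => /andP[].
- move=> i m m' t t'; rewrite !runs_slow_schedule; case: m => // k; case: m' => // k'.
  by case: ifPn => // /andP[/eqP-> _] _; case: ifPn => // /andP[/eqP-> _].
- move=> i iT; exists (Slow i); rewrite runs_slow_schedule eqxx iT /=.
  have [s0 _ _] := hT i iT.
  by rewrite lebesgue_measure_co ?lerDl ?ltW// addrC addKr.
Qed.

Lemma opt_fin_num T : is_tap T -> opt T \is a fin_num.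
Proof.
move=> tT; have [c c0 hc] := ex_ubound (size T) (fun i =>
  arrival (task_at T i) + slow_time (task_at T i)).
rewrite ge0_fin_numE ?opt_ge0//; apply: le_lt_trans (ltry c).
apply: ge_ereal_inf; exists (completion T (slow_schedule T)).
  by exists (slow_schedule T) => //; exact: slow_schedule_valid.
apply: completion_le => // i iT.
have [_ /(_ _ iT)[s0 _ _]] := tT.
exists (Slow i); rewrite runs_slow_schedule eqxx iT /=.
rewrite setIidl; first by rewrite lebesgue_measure_co ?lerDl ?ltW// addrC addKr.
by move=> t /=; rewrite in_itv /= => /andP[_ /ltW/le_trans]; apply; exact: hc.
Qed.

Lemma optE T : is_tap T -> opt T = (copt T)%:E.
Proof. by move=> tT; rewrite fineK// opt_fin_num. Qed.

Lemma copt_ge0 T : is_tap T -> 0 <= copt T.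
Proof. by move=> tT; rewrite -lee_fin -optE// opt_ge0. Qed.

(** The infimum is exploited through schedules that finish before an arbitrary bound above it. *)
Lemma opt_lt T y : is_tap T -> copt T < y ->
  exists S (c : R), [/\ valid_schedule T S, 0 <= c < y & finished_by T S c].
Proof.
move=> tT; rewrite -lte_fin -optE// => /ereal_inf_lt[_ [S vS <-]].
move=> /ereal_inf_lt[_ [c [c0 fc] <-]]; rewrite lte_fin => cy.
by exists S, c; rewrite c0.
Qed.

(** A truncation is a prefix, so dropping the indices from [n] on turns schedules of the instance
    into schedules of the truncation. *)
Definition restrict_schedule (n : nat) S : schedule R := fun m t =>
  if S m t is Some i then if (i < n)%N then Some i else None else None.

Lemma runs_restrict n S m i : runs (restrict_schedule n S) m i =
  if (i < n)%N then runs S m i else set0.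
Proof.
rewrite /runs /restrict_schedule; apply/seteqP; split=> t /=.
  by case e: (S m t) => [j|//]; have [jn [<-]|//] := boolP (j < n)%N; rewrite jn.
by case: ifPn => // iN /= ->; rewrite iN.
Qed.

Lemma copt_trunc t T : is_tap T -> copt (trunc t T) <= copt T.
Proof.
move=> tT; have tT' := tap_trunc t tT.
have szT i : (i < size (trunc t T))%N -> (i < size T)%N.
  by rewrite lt_size_trunc// => /andP[].
rewrite -lee_fin -!optE//; apply/ereal_infP => _ [S [mS aS uS wS] <-].
have vS : valid_schedule (trunc t T) (restrict_schedule (size (trunc t T)) S).
  split.
  - by move=> m i; rewrite runs_restrict; case: ifP.
  - move=> m i u; rewrite runs_restrict; case: ifPn => // iT /aS[_].
    by rewrite task_at_trunc.
  - move=> i m m' u u'; rewrite !runs_restrict; case: ifPn => // _.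
    exact: uS.
  - move=> i iT; have [m h] := wS i (szT i iT).
    by exists m; rewrite runs_restrict iT task_at_trunc.
apply: ge_ereal_inf; exists (completion (trunc t T) (restrict_schedule (size (trunc t T)) S)).
  by exists (restrict_schedule (size (trunc t T)) S).
apply: ereal_inf_le_tmp => _ [c [c0 fc] <-]; exists c => //; split=> // i iT.
have [m h] := fc i (szT i iT).
by exists m; rewrite runs_restrict iT task_at_trunc.
Qed.

(* Above the optimum there is a schedule that is done before any slow start of a task
   of A could be, so all of A occupies the fast machine after time a. *)
Lemma fast_work_le_opt T (A : seq nat) (a : R) : is_tap T -> uniq A ->
  (forall i, i \in A -> [/\ (i < size T)%N,
     copt T < slow_time (task_at T i) + arrival (task_at T i) &
     a <= arrival (task_at T i)]) ->
  a <= copt T -> a + \sum_(i <- A) fast_time (task_at T i) <= copt T.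
Proof.
move=> tT uA hA aC; rewrite leNgt; apply/negP => lt.
(* [y] is the minimum of the sum to be refuted and of the finitely many values slow + arrival, all
   above the optimum. *)
have [y [Cy yle hy]] : exists y, [/\ copt T < y,
    y <= a + \sum_(i <- A) fast_time (task_at T i) &
    forall i, i \in A -> y <= slow_time (task_at T i) + arrival (task_at T i)].
  elim: A {uA} hA {lt}(_ + _) lt => [|i A IH] hA z lt.
    by exists z; split.
  have [|y [Cy yz hy]] := IH _ z lt.
    by move=> j jA; apply: hA; rewrite inE jA orbT.
  have [_ hi _] := hA i (mem_head _ _).
  exists (Num.min y (slow_time (task_at T i) + arrival (task_at T i))); split.
  - by rewrite lt_min Cy.
  - by rewrite ge_min yz.
  - by move=> j; rewrite inE ge_min => /predU1P[->|/hy->//]; rewrite lexx orbT.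
have [S [c [[mS aS uS _] /andP[c0 cy] fc]]] := opt_lt tT Cy.
have mle : measurable [set t : R | t <= c].
  by rewrite -set_itvNyc; exact: measurable_itv.
pose E i := runs S Fast i `&` [set t | t <= c].
have subE i : i \in A -> E i `<=` `[a, c].
  move=> /hA[iT _ ai] t [/aS[_ it] /= tc].
  by rewrite in_itv /= tc (le_trans ai).
have muE i : i \in A -> mu (E i) = (fast_time (task_at T i))%:E.
  move=> iA; have [iT _ _] := hA i iA; have [[|k] //= hk] := fc i iT.
  have [_ /(_ _ iT)[s0 _ t0]] := tT.
  (* By time [c] a slow run has lasted at most [r] minus the arrival; this is less than the slow
     time because c < y. *)
  exfalso; set r := Num.max c (arrival (task_at T i));
  have : (mu (runs S (Slow k) i `&` [set t | (t <= c)%R]) <=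
      mu `[arrival (task_at T i), r])%E.
    apply: le_mu; first by apply: measurableI.
      exact: measurable_itv.
    by move=> t [/aS[_ it] /= tc]; rewrite in_itv /= it /r le_max tc.
  rewrite hk lebesgue_measure_itv /= lte_fin /r; have := hy i iA.
  case: (leP c (arrival (task_at T i))) => h; rewrite ?ltxx ?h ?lee_fin; lra.
have dE i j t : i \in A -> j \in A -> E i t -> E j t -> i = j.
  by move=> _ _ [+ _] [+ _]; rewrite /runs /= => -> [].
have [le_ac|lt_ca] := leP a c.
  have := packing uA le_ac
    (fun i iA => conj (measurableI _ _ (mS Fast i) mle) (subE i iA)) dE.
  rewrite (eq_big_seq (fun i => (fast_time (task_at T i))%:E)) => [|i iA]; last exact: muE.
  by rewrite sumEFin lee_fin; lra.
(* If c < a, no task of [A] can have run by [c], which excludes a nonempty [A]; an empty one would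
   give y <= a <= [copt T]. *)
case: A uA hA yle {hy dE} subE muE {lt} => [|i A] uA hA yle subE muE.
  by move: yle; rewrite big_nil; lra.
have := muE i (mem_head _ _).
suff -> : E i = set0.
  have [iT _ _] := hA i (mem_head _ _); have [_ /(_ _ iT)[_ f0 _]] := tT.
  by rewrite measure0 => -[] e; move: f0; rewrite -e ltxx.
apply/seteqP; split=> // t /(subE i (mem_head _ _)) /=; rewrite in_itv /=.
by lra.
Qed.

Lemma arrival_le_copt T i : is_tap T -> (i < size T)%N ->
  arrival (task_at T i) <= copt T.
Proof.
move=> tT iT; rewrite leNgt; apply/negP => lt.
have [S [c [[mS aS uS _] /andP[c0 cy] fc]]] := opt_lt tT lt.
have [m] := fc i iT; rewrite (_ : _ `&` _ = set0) ?measure0.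
  by case=> e; have := runtime_gt0 m tT iT; rewrite -e ltxx.
by apply/seteqP; split=> // t [/aS[_ it] /= tc]; lra.
Qed.

Lemma fast_time_le_copt T i : is_tap T -> (i < size T)%N ->
  copt T < slow_time (task_at T i) + arrival (task_at T i) ->
  arrival (task_at T i) + fast_time (task_at T i) <= copt T.
Proof.
move=> tT iT lt; have := @fast_work_le_opt T [:: i] (arrival (task_at T i)) tT.
rewrite big_seq1; apply=> //; last exact: arrival_le_copt.
by move=> j; rewrite inE => /eqP->.
Qed.

Lemma copt_trunc_le t u T : is_tap T -> t <= u -> copt (trunc t T) <= copt (trunc u T).
Proof. by move=> tT tu; rewrite -(trunc_trunc T tu) copt_trunc//; exact: tap_trunc. Qed.

Lemma slow_okE (xi : R) T t i : is_tap T ->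
  slow_ok xi T t i <-> slow_time (task_at T i) + t <= xi * copt (trunc t T).
Proof. by move=> tT; rewrite /slow_ok optE ?lee_fin//; exact: tap_trunc. Qed.

End Opt.

(** * Schedules following eve's rules *)

Section EveSchedule.
Variables (R : realType) (xi : R) (tb : tie_rule R).
Hypotheses (xi_gt1 : 1 < xi) (tbP : is_tie_rule tb).
Variables (T : seq (task R)) (S : schedule R).
Hypotheses (tT : is_tap T) (eS : eve_schedule xi tb T S).

Local Notation arr i := (arrival (task_at T i)).
Local Notation slo i := (slow_time (task_at T i)).
Local Notation fas i := (fast_time (task_at T i)).
Local Notation C u := (copt (trunc u T)).

Lemma starts_time_uniq m m' i t t' : starts S m i t -> starts S m' i t' -> t = t'.
Proof.
move=> [rt nt] [rt' nt']; case: (ltgtP t t') => // [/nt'|/nt].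
  by move=> /(_ m).
by move=> /(_ m').
Qed.

Lemma starts_fast i t : starts S Fast i t ->
  waiting xi T S t i /\ candidates xi T S t i /\ forall j, ~ still_active T S t j.
Proof.
case: eS => _ _ /(_ i t) h /h[na cn ->]; have := tbP (trunc t T) t cn.
by move=> ci; split=> //; have [] := ci.
Qed.

Lemma starts_pending m i t : starts S m i t -> pending T S t i.
Proof.
case: m => [/starts_fast[[]]//|k]; case: eS => _ /(_ k i t) h _ /h.
by case.
Qed.

(** Both starts occur at the same time, where [slow_ok] separates slow starts from fast ones, and
    the slow machine is numbered by its task. *)
Lemma starts_machine_uniq m m' i t t' :
  starts S m i t -> starts S m' i t' -> m = m'.
Proof.
move=> st st'; have tt' := starts_time_uniq st st'; rewrite -tt' in st' * => {tt'}.
case: eS => _ h _; case: m st => [|k]; case: m' st' => [|k'] //.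
- by move=> /h[_ _ ok] /starts_fast[[_ /(_ ok)]].
- by move=> /starts_fast[[_ nok]] _ /h[_ _ /nok].
- by move=> /h[-> _ _] /h[-> _ _].
Qed.

Lemma runs_starts m i t : runs S m i t -> exists s, [/\ starts S m i s, s <= t &
  t < s + runtime m (task_at T i)].
Proof. by case: eS => h _ _ /h[s ss /andP[st ts]]; exists s. Qed.

Lemma starts_runs m i s t : starts S m i s -> s <= t ->
  t < s + runtime m (task_at T i) -> runs S m i t.
Proof. by case: eS => h _ _ ss st ts; apply/h; exists s => //; rewrite st ts. Qed.

Lemma starts_not_before m i s u : starts S m i s -> arr i <= u <= s -> pending T S u i.
Proof.
move=> ss /andP[au us]; have [iT _ nr] := starts_pending ss; split=> // m' v vu.
by apply: nr; exact: lt_le_trans us.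
Qed.

(** The task is pending throughout, so the slow rule would otherwise have started it at [u]. *)
Lemma starts_fast_gt i s u : starts S Fast i s -> arr i <= u <= s ->
  xi * C u < slo i + u.
Proof.
move=> ss /[dup]/andP[au us] aus; rewrite ltNge; apply/negP.
move=> /(slow_okE xi u i tT) ok; case: (eS) => _ h _.
have su : starts S (Slow i) i u by apply/h; split=> //; exact: starts_not_before ss aus.
by have := starts_machine_uniq ss su.
Qed.

(** If no task is still active, a waiting task of largest slow time plus arrival is a candidate, and
    the last rule starts one at [u]. *)
Lemma waiting_busy i u : waiting xi T S u i -> exists j, runs S Fast j u.
Proof.
move=> wi; have [[j [s [ss su us]]]|na] := pselect (exists j, still_active T S u j).
  by exists j; apply: starts_runs ss _ _ => //; exact: ltW.
have [|j cj] := @ex_max_candidate R T (waiting xi T S u) i _ wi.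
  by move=> j [[]].
case: (eS) => _ _ h; exists (tb (trunc u T) u (candidates xi T S u)).
suff [] : starts S Fast (tb (trunc u T) u (candidates xi T S u)) u by [].
apply/h; split=> //; first by move=> k ak; apply: na; exists k.
by exists j.
Qed.

Lemma starts_fast_busy i s u : starts S Fast i s -> arr i <= u <= s ->
  exists j, runs S Fast j u.
Proof.
move=> ss aus; apply: (@waiting_busy i); split; first exact: starts_not_before ss aus.
by move=> /(slow_okE xi u i tT); rewrite leNgt (starts_fast_gt ss aus).
Qed.

(** At [s] the task [j] is itself waiting, since it starts fast only later, and [i] was preferred to
    it. *)
Lemma starts_fast_priority i j s s' : starts S Fast i s -> starts S Fast j s' ->
  s < s' -> arr j <= s -> slo j + arr j <= slo i + arr i.
Proof.
move=> ss ss' lt as_; have [_ [[_ h] _]] := starts_fast ss; apply: h.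
have b : arr j <= s <= s' by rewrite as_ ltW.
split; first exact: starts_not_before ss' b.
by move=> /(slow_okE xi s j tT); rewrite leNgt (starts_fast_gt ss' b).
Qed.

(** A task that never starts would wait forever and keep the fast machine busy beyond the last fast
    completion. *)
Lemma eventually_starts i : (i < size T)%N -> exists m s, starts S m i s.
Proof.
move=> iT; apply: contrapT => ns.
have nr m t : ~ runs S m i t.
  by move=> /runs_starts[s [ss _ _]]; apply: ns; exists m, s.
have pi t : arr i <= t -> pending T S t i by split=> // m s _; exact: nr.
(* The default 0 concerns tasks without a fast start, for which the bound is not read. *)
pose e j := xget 0 [set s | starts S Fast j s] + fas j.
have [c c0 hc] := ex_ubound (size T) e.
have [|j /runs_starts[s [ss sr rs]]] := @waiting_busy i (Num.max c (arr i)).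
  have p := pi (Num.max c (arr i)); split; first by apply: p; rewrite le_max lexx orbT.
  move=> ok; apply: ns; exists (Slow i), (Num.max c (arr i)).
  by case: (eS) => _ h _; apply/h; split=> //; apply: p; rewrite le_max lexx orbT.
have [jT _ _] := starts_pending ss.
have := hc j jT; rewrite /e (_ : xget _ _ = s).
  by move: rs => /=; rewrite ltNge => /negP rs h; apply: rs; rewrite le_max h.
by apply: xget_unique => // y sy; exact: starts_time_uniq sy ss.
Qed.

Lemma runs_startsE m i s : starts S m i s ->
  runs S m i = `[s, s + runtime m (task_at T i)[%classic.
Proof.
move=> ss; apply/seteqP; split=> t /=; rewrite in_itv /=.
  by move=> /runs_starts[s' [/(starts_time_uniq ss) <- -> ->]].
by case/andP; exact: starts_runs ss.
Qed.

Lemma mu_runs_starts m i s : (i < size T)%N -> starts S m i s ->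
  lebesgue_measure (runs S m i) = (runtime m (task_at T i))%:E.
Proof.
move=> iT ss; rewrite (runs_startsE ss) lebesgue_measure_co ?lerDl ?ltW ?runtime_gt0//.
by rewrite addrC addKr.
Qed.

Lemma eve_valid : valid_schedule T S.
Proof.
split.
- move=> m i; have [[s ss]|ns] := pselect (exists s, starts S m i s).
    by rewrite (runs_startsE ss); exact: measurable_itv.
  rewrite (_ : runs S m i = set0)//; apply/seteqP; split=> // t.
  by move=> /runs_starts[s [ss _ _]]; case: ns; exists s.
- move=> m i t /runs_starts[s [ss st _]]; have [iT as_ _] := starts_pending ss.
  by split=> //; exact: le_trans st.
- move=> i m m' t t' /runs_starts[s [ss _ _]] /runs_starts[s' [ss' _ _]].
  exact: starts_machine_uniq ss ss'.
- move=> i iT; have [m [s ss]] := eventually_starts iT.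
  by exists m; exact: mu_runs_starts ss.
Qed.

Lemma slow_finish k i s : starts S (Slow k) i s -> s + slo i <= xi * copt T.
Proof.
case: (eS) => _ h _ /h[_ _] /(slow_okE xi s i tT); rewrite addrC => /le_trans; apply.
by rewrite ler_pM2l ?copt_trunc// (lt_trans ltr01).
Qed.

Lemma eve_finished c : (forall m i s, starts S m i s ->
    s + runtime m (task_at T i) <= c) -> finished_by T S c.
Proof.
move=> hc i iT; have [m [s ss]] := eventually_starts iT; exists m.
rewrite setIidl; first exact: mu_runs_starts ss.
move=> t /runs_starts[s' [ss' _ /ltW ts]] /=; apply: le_trans ts _; exact: hc ss'.
Qed.

Definition start_time i : R := xget 0 [set s | exists m, starts S m i s].

Lemma start_timeE m i s : starts S m i s -> start_time i = s.
Proof.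
move=> ss; apply: xget_unique; first by exists m.
by move=> y [m' sy]; exact: starts_time_uniq sy ss.
Qed.

Definition fast_tasks : seq nat :=
  [seq i <- iota 0 (size T) | `[< starts S Fast i (start_time i) >] ].

Lemma fast_tasksP i : reflect (starts S Fast i (start_time i)) (i \in fast_tasks).
Proof.
rewrite mem_filter mem_iota add0n /=; apply: (iffP idP).
  by case/andP => /asboolP.
by move=> ss; rewrite asboolT//=; case: (starts_pending ss).
Qed.

Lemma runs_fast_tasks i t : runs S Fast i t ->
  i \in fast_tasks /\ start_time i <= t < start_time i + fas i.
Proof.
move=> /runs_starts[s [ss st ts]]; have e := start_timeE ss; rewrite e st ts.
by split=> //; apply/fast_tasksP; rewrite e.
Qed.

End EveSchedule.

(** * Eve is online: its decisions up to a time depend only on the truncation *)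

Lemma task_at_eq_trunc (R : realType) (T T' : seq (task R)) (t : R) i :
  is_tap T -> is_tap T' -> trunc t T = trunc t T' -> (i < size T)%N ->
  arrival (task_at T i) <= t -> (i < size T')%N /\ task_at T' i = task_at T i.
Proof.
move=> tT tT' e iT it; have : (i < size (trunc t T))%N by rewrite lt_size_trunc// iT.
move=> /[dup] /(task_at_trunc tT) <-; rewrite e => i'; rewrite (task_at_trunc tT' i').
by move: i'; rewrite lt_size_trunc// => /andP[].
Qed.

Lemma trunc_eq_le (R : realType) (T T' : seq (task R)) (u t : R) :
  u <= t -> trunc t T = trunc t T' -> trunc u T = trunc u T'.
Proof. by move=> ut e; rewrite -(trunc_trunc T ut) e trunc_trunc. Qed.

Section Online.
Variables (R : realType) (xi : R) (tb : tie_rule R).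
Hypothesis tbP : is_tie_rule tb.
Implicit Types (T : seq (task R)) (S : schedule R).

Lemma runs_starts_imply T T' S S' t s m i : is_tap T -> is_tap T' ->
  eve_schedule xi tb T S -> eve_schedule xi tb T' S' -> trunc t T = trunc t T' ->
  s <= t -> (forall u m i, u <= s -> starts S m i u -> starts S' m i u) ->
  runs S m i s -> runs S' m i s.
Proof.
move=> tT tT' eS eS' e st h /(runs_starts eS)[u [su us ru]].
have [iT iu _] := starts_pending tbP eS su.
have [_ ei] := task_at_eq_trunc tT tT' e iT (le_trans iu (le_trans us st)).
by apply: (starts_runs eS' (h _ _ _ us su) us); rewrite ei.
Qed.

Lemma pending_starts_imply T T' S S' t i : is_tap T -> is_tap T' ->
  eve_schedule xi tb T S -> eve_schedule xi tb T' S' -> trunc t T = trunc t T' ->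
  (forall u m i, u < t -> starts S' m i u -> starts S m i u) ->
  pending T S t i -> pending T' S' t i.
Proof.
move=> tT tT' eS eS' e h [iT it nr].
have [iT' ei] := task_at_eq_trunc tT tT' e iT it; split=> //; first by rewrite ei.
move=> m s st rs; apply: (nr m s st).
apply: (runs_starts_imply tT' tT eS' eS (esym e) (ltW st) _ rs) => u m' j us.
by apply: h; exact: le_lt_trans st.
Qed.

(** The rules at time [t] refer only to the truncation at [t] and to the starts before [t]. *)
Lemma starts_step T T' S S' t m i : is_tap T -> is_tap T' ->
  eve_schedule xi tb T S -> eve_schedule xi tb T' S' -> trunc t T = trunc t T' ->
  (forall u m i, u < t -> starts S m i u <-> starts S' m i u) ->
  starts S m i t -> starts S' m i t.
Proof.
move=> tT tT' eS eS' e h.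
have pE j : pending T S t j <-> pending T' S' t j.
  split; first by apply: pending_starts_imply => // u m' k ut /h; exact.
  by apply: pending_starts_imply => // u m' k ut /h; exact.
have tE j : pending T S t j -> task_at T' j = task_at T j.
  by case=> jT jt _; case: (task_at_eq_trunc tT tT' e jT jt).
have okE j : pending T S t j -> slow_ok xi T t j <-> slow_ok xi T' t j.
  by move=> /tE ej; rewrite /slow_ok -e ej.
have wE j : waiting xi T S t j <-> waiting xi T' S' t j.
  split; move=> [pj nok].
    by split; [exact/pE|move/(okE _ pj)].
  have pj' := (pE j).2 pj.
  by split => //; move/(okE _ pj').
have tw j : waiting xi T S t j -> task_at T' j = task_at T j by case=> /tE.
have cE : candidates xi T S t = candidates xi T' S' t.
  apply/seteqP; split=> j [wj mj].
    split; first exact/wE.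
    move=> k wk; have wk' := (wE k).2 wk; rewrite !tw//; exact: mj.
  have wj' := (wE j).2 wj; split => // k wk; rewrite -!tw//; apply: mj; exact/wE.
case: (eS) (eS') => _ hs hf [_ hs' hf'].
case: m => [/hf[na cn ie]|k /hs[ki pi ok]].
  apply/hf'; split; rewrite -?cE -?e// => j [s [ss st ts]].
  have ss' := (h _ _ _ st).2 ss; have [jT js _] := starts_pending tbP eS ss'.
  have [_ ej] := task_at_eq_trunc tT tT' e jT (le_trans js (ltW st)).
  by apply: (na j); exists s; rewrite -ej.
by apply/hs'; split=> //; [exact/pE|exact/(okE _ pi)].
Qed.

(** Disagreements can occur only at the finitely many start times of the two schedules, so there
    would be an earliest one, which [starts_step] excludes. *)
Lemma starts_eq_trunc T T' S S' t u m i : is_tap T -> is_tap T' ->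
  eve_schedule xi tb T S -> eve_schedule xi tb T' S' -> trunc t T = trunc t T' ->
  u <= t -> starts S m i u <-> starts S' m i u.
Proof.
move=> tT tT' eS eS' e ut.
pose E := map (start_time S) (iota 0 (size T)) ++ map (start_time S') (iota 0 (size T')).
pose P v := v <= t /\ exists m i, ~ (starts S m i v <-> starts S' m i v).
have PE v : P v -> v \in E.
  move=> [vt [m' [j nj]]]; rewrite mem_cat.
  have [sj|nsj] := pselect (starts S m' j v).
    have [jT _ _] := starts_pending tbP eS sj.
    by rewrite -(start_timeE sj) map_f// mem_iota.
  have [sj|nsj'] := pselect (starts S' m' j v); last by case: nj.
  have [jT _ _] := starts_pending tbP eS' sj.
  by rewrite orbC -(start_timeE sj) map_f// mem_iota.
apply: contrapT => ne.
have [|v [_ [vt [m' [j nj]]] mv]] := @ex_argmin R R E id P.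
  by exists u; [apply: PE|]; split=> //; exists m, i.
apply: nj; have h s k l : s < v -> starts S k l s <-> starts S' k l s.
  move=> sv; apply: contrapT => nkl.
  have Ps : P s by split; [exact: le_trans (ltW sv) vt|exists k, l].
  by have := mv s (PE s Ps) Ps; rewrite leNgt sv.
have ev := trunc_eq_le vt e.
split; first exact: (starts_step tT tT' eS eS' ev h).
apply: (starts_step tT' tT eS' eS (esym ev)) => s k l sv.
by split=> hs; apply/(h _ _ _ sv).
Qed.

Lemma eve_online T T' S S' t m s : is_tap T -> is_tap T' ->
  eve_schedule xi tb T S -> eve_schedule xi tb T' S' -> trunc t T = trunc t T' ->
  s <= t -> S m s = S' m s.
Proof.
move=> tT tT' eS eS' e st.
have h i : runs S m i s -> runs S' m i s.
  apply: (runs_starts_imply tT tT' eS eS' e st) => u m' j us.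
  by case: (starts_eq_trunc m' j tT tT' eS eS' e (le_trans us st)).
have h' i : runs S' m i s -> runs S m i s.
  apply: (runs_starts_imply tT' tT eS' eS (esym e) st) => u m' j us.
  by case: (starts_eq_trunc m' j tT tT' eS eS' e (le_trans us st)).
move: h h'; rewrite /runs /=; case: (S m s) => [i /(_ i erefl)->//|_].
by case: (S' m s) => [i /(_ i erefl)|].
Qed.

End Online.

(** * The fast machine *)

Section FastMachine.
(** [B] stands for the tasks run on the fast machine and [st] for their start times. The hypotheses
    collect what the bound uses of eve's schedule; [fast_finish] checks them. *)
Variables (R : realType) (xi : R) (T : seq (task R)) (B : seq nat) (st : nat -> R).

Local Notation arr i := (arrival (task_at T i)).
Local Notation slo i := (slow_time (task_at T i)).
Local Notation fas i := (fast_time (task_at T i)).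
Local Notation C u := (copt (trunc u T)).
Local Notation q i := (slo i + arr i).

Hypotheses (tT : is_tap T) (uB : uniq B).
Hypothesis B_size : forall i, i \in B -> (i < size T)%N.
Hypothesis B_arr : forall i, i \in B -> arr i <= st i.
Hypothesis B_disj : forall i j, i \in B -> j \in B ->
  st i <= st j < st i + fas i -> i = j.
Hypothesis B_slow : forall i u, i \in B -> arr i <= u <= st i ->
  xi * C u < slo i + u.
Hypothesis B_busy : forall i u, i \in B -> arr i <= u <= st i ->
  exists2 j, j \in B & st j <= u < st j + fas j.
Hypothesis B_prio : forall i j, i \in B -> j \in B -> st i < st j ->
  arr j <= st i -> q j <= q i.

Lemma B_fast_gt0 i : i \in B -> 0 < fas i.
Proof. by move=> /B_size; exact: (runtime_gt0 Fast). Qed.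

Lemma B_arr_ge0 i : i \in B -> 0 <= arr i.
Proof. by move=> /B_size iT; case: tT => _ /(_ i iT)[]. Qed.

(** [Hi] selects the tasks with large q. [A] is the run of [Hi] tasks ending with [l], and [a] is
    either the start of the last other task [x] before it, of length [p], or the beginning of the
    busy stretch. *)
Lemma busy_period (Hi : pred nat) l : l \in B -> Hi l ->
  (forall i j, i \in B -> j \in B -> Hi i -> q i <= q j -> Hi j) ->
  exists a p (A : seq nat),
    [/\ [/\ uniq A, l \in A & st l + fas l <= a + p + \sum_(i <- A) fas i],
        forall i, i \in A -> [/\ i \in B, Hi i, a <= arr i & st i <= st l],
        forall i, i \in B -> a < st i <= st l -> i \in A &
        p = 0 \/ exists2 x, x \in B & [/\ st x = a, fas x = p & ~~ Hi x]].
Proof.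
move=> Bl Hl upHi.
(* [Z i] says that the fast machine is busy from the start of [i] to that of [l]; the earliest such
   task [b] opens the stretch. *)
pose Z i := st i <= st l /\
  forall u, st i <= u < st l -> exists2 j, j \in B & st j <= u < st j + fas j.
have Zl : Z l by split=> // u /andP[lu ul]; lra.
have [|b [Bb [bl Zb] minb]] := @ex_argmin R _ B st Z; first by exists l.
(* At an arrival before [st b] the machine would be running a task that starts before [b] and
   satisfies [Z] as well. *)
have arr_ge j : j \in B -> st b <= st j <= st l -> st b <= arr j.
  move=> Bj /andP[bj jl]; rewrite leNgt; apply/negP => ltb.
  have [|k Bk /andP[ku uk]] := B_busy Bj (u := arr j); first by rewrite lexx B_arr.
  have Zk : Z k.
    split; first lra.
    move=> u /andP[ku' ul].
    have [uaj|aju] := ltP u (arr j); first by exists k => //; rewrite ku'; lra.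
    have [ub|bu] := ltP u (st b); last by apply: Zb; rewrite bu.
    by apply: (B_busy Bj); rewrite aju; lra.
  by have := minb k Bk Zk; lra.
have B_lt j : j \in B -> ~~ Hi j -> st j <= st l -> st j < st l.
  move=> Bj nHj; rewrite le_eqVlt => /predU1P[e|//]; move: nHj.
  by rewrite (B_disj Bj Bl) ?Hl// e lexx ltrDl B_fast_gt0.
have covl u : st b <= u < st l + fas l ->
    exists2 j, (j \in B) && (st j <= st l) & st j <= u < st j + fas j.
  move=> /andP[bu ul]; have [lu|lu] := leP (st l) u.
    by exists l; rewrite ?Bl ?lexx// lu.
  have [|j Bj /andP[ju uj]] := Zb u; first by rewrite bu.
  by exists j; rewrite ?Bj ?ju//=; lra.
have [|nx] := pselect (exists2 x, x \in B & ~~ Hi x /\ st b <= st x < st l).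
  move=> /(@ex_argmax R _ B st)[x [Bx [nHx /andP[bx xl]] maxx]].
  pose A := [seq j <- B | st x < st j <= st l].
  have AE j : (j \in A) = (st x < st j <= st l) && (j \in B) by rewrite mem_filter.
  have HA j : j \in A -> Hi j.
    rewrite AE => /andP[/andP[xj jl] Bj]; apply: contraLR xj => nHj; rewrite -leNgt.
    have [jb|bj] := ltP (st j) (st b); first by rewrite (le_trans (ltW jb)).
    by apply: maxx => //; split=> //; rewrite bj B_lt.
  exists (st x), (fas x), A; split.
  - split; [exact: filter_uniq|by rewrite AE xl lexx|].
    have := @cover_le_sum R (x :: A) st (fun i => st i + fas i) (st x) (st l + fas l).
    rewrite big_cons (eq_bigr (fun i => fas i)) => [|i _]; last by rewrite addrC addKr.
    rewrite [X in X - _]addrC addrK addrA; apply.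
      move=> i iA; rewrite lerDl ltW// B_fast_gt0//.
      by move: iA; rewrite inE AE => /predU1P[->//|/andP[]].
    move=> u /andP[xu ul]; have [|j /andP[Bj jl] /andP[ju uj]] := covl u.
      by rewrite ul (le_trans bx).
    exists j; last by rewrite ju.
    rewrite inE AE Bj jl !andbT; have [_|jx] := ltP (st x) (st j); first by rewrite orbT.
    by rewrite (B_disj Bj Bx) ?eqxx// jx (le_lt_trans xu).
  - move=> j jA; have Hj := HA j jA; move: jA; rewrite AE => /andP[/andP[xj jl] Bj].
    split=> //; rewrite leNgt; apply: contra nHx => ajx.
    (* Had [j] arrived by the start of [x], priority would give q j <= q x and put [x] in [Hi]. *)
    by apply: upHi Hj _ => //; apply: B_prio => //; exact: ltW.
  - by move=> j Bj h; rewrite AE h.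
  - by right; exists x.
pose A := [seq j <- B | st b <= st j <= st l].
have AE j : (j \in A) = (st b <= st j <= st l) && (j \in B) by rewrite mem_filter.
exists (st b), 0, A; split.
- split; [exact: filter_uniq|by rewrite AE bl lexx|].
  have := @cover_le_sum R A st (fun i => st i + fas i) (st b) (st l + fas l).
  rewrite (eq_bigr (fun i => fas i)) => [|i _]; last by rewrite addrC addKr.
  rewrite addr0; apply.
    move=> i; rewrite AE => /andP[_ Bi].
    by rewrite lerDl ltW// B_fast_gt0.
  move=> u /[dup] bul /andP[bu ul]; have [j /andP[Bj jl] /andP[ju uj]] := covl u bul.
  exists j; last by rewrite ju.
  rewrite AE Bj jl !andbT leNgt; apply/negP => jb.
  have Zj : Z j.
    split=> // v /andP[jv vl]; have [vb|bv] := ltP v (st b); last by apply: Zb; rewrite bv.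
    by exists j => //; rewrite jv; lra.
  by have := minb j Bj Zj; rewrite leNgt jb.
- move=> j; rewrite AE => /andP[bjl Bj]; split=> //; last by case/andP: bjl.
    apply/negPn/negP => nHj; apply: nx; exists j => //; split=> //.
    by case/andP: bjl => bj jl; rewrite bj B_lt.
  exact: arr_ge.
- by move=> j Bj /andP[bj jl]; rewrite AE Bj jl ltW.
- by left.
Qed.

Lemma trunc_copt : trunc (copt T) T = T.
Proof. by apply: trunc_id => // i iT; exact: arrival_le_copt. Qed.

Lemma arr_le_trunc t i : (i < size T)%N -> arr i <= t -> arr i <= C t.
Proof.
move=> iT it; have iT' : (i < size (trunc t T))%N by rewrite lt_size_trunc// iT.
by have := arrival_le_copt (tap_trunc t tT) iT'; rewrite task_at_trunc.
Qed.

Lemma trunc_fast_work t (A : seq nat) (P : pred nat) a : uniq A -> a <= C t ->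
  (forall i, i \in A -> P i -> [/\ (i < size T)%N, arr i <= t, C t < q i & a <= arr i]) ->
  a + \sum_(i <- A | P i) fas i <= C t.
Proof.
move=> uA aC hA; rewrite -big_filter.
have hT i : i \in [seq i <- A | P i] -> (i < size (trunc t T))%N.
  by rewrite mem_filter => /andP[Pi Ai]; have [iT it _ _] := hA i Ai Pi;
    rewrite lt_size_trunc// iT.
rewrite (eq_big_seq (fun i => fast_time (task_at (trunc t T) i))); last first.
  by move=> i /hT iT; rewrite task_at_trunc.
apply: fast_work_le_opt => //; [exact: tap_trunc|exact: filter_uniq|].
move=> i iA; have iT := hT i iA; rewrite !task_at_trunc//.
by move: iA; rewrite mem_filter => /andP[Pi Ai]; case: (hA i Ai Pi).
Qed.

Hypothesis xi_gt1 : 1 < xi.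
Local Notation K := (xi^-1).
Hypotheses (xi_ge : 1 + K <= xi) (xi_root : K * K = 2 * xi - 3).

Lemma trunc_arr_lt i : i \in B -> C (arr i) < K * q i.
Proof.
move=> Bi; rewrite mulrC ltr_pdivlMr ?(lt_trans ltr01)// mulrC.
by apply: B_slow => //; rewrite lexx B_arr.
Qed.

Lemma fast_arr_le i : i \in B -> fas i + arr i <= C (arr i).
Proof.
move=> Bi; have iT := B_size Bi; rewrite addrC.
have iT' : (i < size (trunc (arr i) T))%N by rewrite lt_size_trunc// iT /=.
have := fast_time_le_copt (tap_trunc (arr i) tT) iT'; rewrite !task_at_trunc//; apply.
have := @B_slow i (arr i) Bi; rewrite lexx B_arr// => /(_ isT); apply: le_lt_trans.
by rewrite ler_peMl ?copt_ge0 ?ltW//; exact: tap_trunc.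
Qed.

(** The induction hypothesis on truncations of smaller optimum, phrased as a bound on the fast work
    still left at time [t]. *)
Hypothesis remaining_le : forall t i, copt (trunc t T) < copt T -> i \in B ->
  arr i <= t < st i ->
  t + \sum_(j <- B | (arr j <= t) && (t < st j + fas j))
        (st j + fas j - Num.max (st j) t) <= xi * C t.

Lemma fast_completion l : l \in B -> st l + fas l <= xi * copt T.
Proof.
move=> Bl; rewrite leNgt; apply/negP => ltF; set D1 := copt T in ltF *.
have xi0 : 0 < xi by exact: lt_trans xi_gt1.
have K0 : 0 < K by rewrite invr_gt0.
have K1 : K < 1 by rewrite invf_lt1.
have D10 : 0 <= D1 by exact: copt_ge0.
have KKD : K * (K * D1) = (2 * xi - 3) * D1 by rewrite mulrA xi_root.
have KD : D1 + K * D1 <= xi * D1 by rewrite -{1}[D1]mul1r -mulrDl ler_wpM2r.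
have KD0 : 0 <= K * D1 by rewrite mulr_ge0// ltW.
have C1 : C D1 = D1 by rewrite /D1 trunc_copt.
have arrD i : (i < size T)%N -> arr i <= D1 by exact: arrival_le_copt.
have fasK i : i \in B -> fas i < K * q i.
  move=> Bi; have := trunc_arr_lt Bi; have := fast_arr_le Bi.
  by have := B_arr_ge0 Bi; lra.
have Kle x y : x <= y -> K * x <= K * y by move=> xy; rewrite ler_pM2l.
(* If D1 < q l, all of [A] is forced onto the fast machine and p <= K * D1, so the finish is at most
   D1 + K * D1. *)
have [qD|qD] := ltP D1 (q l).
  have [|a [p [A [[uA lA FA] hA _ hp]]]] := @busy_period (fun i => D1 < q i) l Bl qD.
    by move=> i j _ _; exact: lt_le_trans.
  have := @trunc_fast_work D1 A xpredT a uA; rewrite C1 => /(_ _ _)/wrap[].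
    have [Ba _ al _] := hA l lA; apply: le_trans al _; exact/arrD/B_size.
    by move=> i /hA[Bi ? ? ?] _; split=> //; [exact: B_size|exact/arrD/B_size].
  case: hp => [p0|[x Bx [_ px]]]; first lra.
  by rewrite -leNgt => /Kle; have := fasK x Bx; lra.
(* The task [l] has fast time below K * D1 but finishes after D1 + K * D1. *)
have stl : D1 < st l by have := fasK l Bl; have := Kle _ _ qD; lra.
have [|a [p [A [[uA lA FA] hA Ain hp]]]] := @busy_period (fun i => q l <= q i) l Bl (lexx _).
  by move=> i j _ _; exact: le_trans.
have [|i0 [Ai0 qi0 maxi0]] := @ex_argmax R _ A (fun i => arr i) (fun i => q i <= D1).
  by exists l.
set t := arr i0 in maxi0; have [Bi0 _ ai0 _] := hA i0 Ai0; set D := C t.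
have tD : t <= D by apply: arr_le_trunc => //; exact: B_size.
have t0 : 0 <= t by exact: B_arr_ge0.
have DK : D < K * D1 by apply: lt_le_trans (trunc_arr_lt Bi0) (Kle _ _ qi0).
have KD1 : K * D1 <= D1 by rewrite ler_piMl// ltW.
have DD1 : D < D1 by lra.
have [_ _ al _] := hA l lA.
have lt : arr l <= t by exact: maxi0.
have heavy i : i \in A -> t < arr i -> D1 < q i.
  by move=> Ai; rewrite ltNge; apply: contraNlt => /(maxi0 i Ai).
have work_after A' (P : pred nat) th : uniq A' -> th <= D1 ->
    (forall i, i \in A' -> P i -> [/\ i \in A, t < arr i & th <= arr i]) ->
    th + \sum_(i <- A' | P i) fas i <= D1.
  move=> uA' thD hA'; rewrite -[leRHS]C1; apply: trunc_fast_work; rewrite ?C1//.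
  move=> i Ai' Pi; have [Ai ti thi] := hA' i Ai' Pi; have [Bi _ _ _] := hA i Ai.
  by split=> //; [exact: B_size|exact/arrD/B_size|exact: heavy].
(* If q l <= D, the work done from [t] on is at most xi * D - t for the tasks arrived by [t] and D1
   - t for the later ones; xi * D < slo l + t then bounds the finish by D1 + q l. *)
have [qlD|Dql] := leP (q l) D.
  have := remaining_le DD1 Bl (t := t); rewrite lt/= -/D => /(_ _)/wrap[]; first lra.
  (* The tasks occupying the machine between [t] and the end of [l]; their intervals are clipped at
     [t] below. *)
  pose A' := [seq j <- B | (t < st j + fas j) && (st j <= st l)].
  have A'E j : (j \in A') = (t < st j + fas j) && (st j <= st l) && (j \in B).
    by rewrite mem_filter.
  have := @cover_le_sum R A' (fun j => Num.max (st j) t) (fun j => st j + fas j)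
    t (st l + fas l).
  move=> /(_ _ _)/wrap[].
  - move=> j; rewrite A'E => /andP[/andP[tj _] Bj].
    by rewrite ge_max (ltW tj) lerDl ltW// B_fast_gt0.
  - move=> u /andP[tu ul]; have [lu|ul'] := leP (st l) u.
      exists l; last by rewrite ge_max lu tu.
      by rewrite A'E Bl lexx (le_lt_trans tu).
    have [|j Bj /andP[ju uj]] := B_busy Bl (u := u); first by rewrite (le_trans lt tu) ltW.
    exists j; last by rewrite ge_max ju tu.
    by rewrite A'E Bj (le_lt_trans tu)//= andbT (le_trans ju)// ltW.
  rewrite (bigID (fun j => arr j <= t))/=.
  have := work_after A' (fun j => ~~ (arr j <= t)) t (filter_uniq _ uB).
  rewrite (ltW (le_lt_trans tD DD1)) => /(_ isT) /(_ _)/wrap[].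
    (* A task arriving after [t] starts after [a], hence belongs to [A]. *)
    move=> j; rewrite A'E => /andP[/andP[_ jl] Bj]; rewrite -ltNge => tj.
    split=> //; last exact: ltW.
    apply: Ain => //; rewrite jl andbT; have := B_arr Bj; lra.
  have -> : \sum_(j <- A' | ~~ (arr j <= t)) (st j + fas j - Num.max (st j) t) =
      \sum_(j <- A' | ~~ (arr j <= t)) fas j.
    rewrite big_seq_cond [RHS]big_seq_cond; apply: eq_bigr => j /andP[].
    rewrite A'E => /andP[_ Bj]; rewrite -ltNge => tj.
    by rewrite max_l ?(le_trans (ltW tj)) ?B_arr// addrC addKr.
  have : \sum_(j <- A' | arr j <= t) (st j + fas j - Num.max (st j) t) <=
      \sum_(j <- B | (arr j <= t) && (t < st j + fas j))
        (st j + fas j - Num.max (st j) t).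
    rewrite big_filter_cond big_seq_cond [leRHS]big_seq_cond.
    rewrite [leRHS](bigID (fun j => st j <= st l))/=.
    rewrite [X in X <= _](eq_bigl (fun j =>
      (j \in B) && ((arr j <= t) && (t < st j + fas j)) && (st j <= st l))); last first.
      by move=> j; rewrite -!andbA; do ![case: (_ <= _)|case: (_ < _)|case: (_ \in _)].
    rewrite lerDl sumr_ge0// => j /andP[/andP[Bj /andP[_ tj]] _].
    by rewrite subr_ge0 ge_max (ltW tj) lerDl ltW// B_fast_gt0.
  have : xi * D < slo l + t by apply: B_slow => //; rewrite lt; lra.
  have := B_arr_ge0 Bl; lra.
have [_ _ _ stal] := hA l lA.
have aD : a <= D by lra.
have before := @trunc_fast_work t A (fun i => arr i <= t) a uA aD.
have {before} : a + \sum_(i <- A | arr i <= t) fas i <= D.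
  apply: before => i Ai ti; have [Bi qi ai _] := hA i Ai; split=> //.
    exact: B_size.
  exact: lt_le_trans qi.
have : t + \sum_(i <- A | ~~ (arr i <= t)) fas i <= D1.
  apply: work_after => //; first lra.
  by move=> i Ai; rewrite -ltNge => ti; split=> //; exact: ltW.
have SA : \sum_(i <- A) fas i =
    \sum_(i <- A | arr i <= t) fas i + \sum_(i <- A | ~~ (arr i <= t)) fas i.
  by rewrite (bigID (fun i => arr i <= t)).
(* Without [x], the two bounds already give a finish of at most D + D1. *)
case: hp => [p0|[x Bx [xa px nHx]]]; first lra.
have xt : arr x <= t by rewrite (le_trans (B_arr Bx))// xa; lra.
(* If D < q x, the task [x] is forced at [t] too. It arrived before [a], so the work is counted from
   0, and a <= t absorbs the loss. *)
have [Dqx|qxD] := ltP D (q x).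
  have : 0 + \sum_(i <- x :: A | arr i <= t) fas i <= D.
    apply: trunc_fast_work; [|exact: le_trans t0 tD|].
      rewrite /= uA andbT; apply: contra nHx => /hA[_ + _ _]; exact.
    move=> i; rewrite inE => /predU1P[->|Ai] ti.
      by split=> //; [exact: B_size|exact: B_arr_ge0].
    have [Bi qi _ _] := hA i Ai; split=> //; [exact: B_size|exact: lt_le_trans qi|].
    exact: B_arr_ge0.
  rewrite big_cons xt; lra.
move=> _ _.
(* The two factors of K come from p < K * q x with q x <= D, and from D < K * D1. *)
have pK : p <= K * (K * D1).
  by rewrite -px; have := fasK x Bx; have := Kle _ _ qxD; have := Kle _ _ (ltW DK); lra.
have [|j0 [j0T qj0 minj0]] := @ex_argmin R _ (iota 0 (size T)) (fun j => arr j)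
    (fun j => q l <= C (arr j)).
  (* At the last arrival the truncation is all of [T], whose optimum D1 is at least q l. *)
  have [|j [jT _ maxj]] := @ex_argmax R _ (iota 0 (size T)) (fun j => arr j) xpredT.
    by exists l; rewrite // mem_iota B_size.
  exists j => //; rewrite trunc_id// => i iT; apply: maxj => //.
  by rewrite mem_iota.
set th := arr j0 in qj0 minj0; move: j0T; rewrite mem_iota /= add0n => j0T.
have tth : t < th.
  by rewrite ltNge; apply/negP => /(copt_trunc_le tT); rewrite -/D; lra.
have thD : th <= D1 by exact: arrD.
(* The optimum just before [th] is read off at the last earlier arrival; it is below q l, so the
   work of [A] that arrived before [th] is forced there. *)
have [|j1 [j1T j1th maxj1]] := @ex_argmax R _ (iota 0 (size T)) (fun j => arr j)
    (fun j => arr j < th).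
  by exists l; [rewrite mem_iota B_size|lra].
have qj1 : C (arr j1) < q l.
  by rewrite ltNge; apply/negP => /(minj0 _ j1T); lra.
have : a + \sum_(i <- A | arr i < th) fas i <= C (arr j1).
  have lj1 : arr l <= arr j1 by apply: maxj1; [rewrite mem_iota B_size|lra].
  apply: trunc_fast_work => //.
    by apply: le_trans al (arr_le_trunc _ lj1); exact: B_size.
  move=> i Ai ith; have [Bi qi ai _] := hA i Ai; split=> //.
  - exact: B_size.
  - by apply: maxj1 => //; rewrite mem_iota B_size.
  - exact: lt_le_trans qi.
have : th + \sum_(i <- A | ~~ (arr i < th)) fas i <= D1.
  apply: work_after => // i Ai; rewrite -leNgt => thi; split=> //; lra.
have : xi * C th < slo l + th by apply: B_slow => //; apply/andP; split; lra.
have : xi * q l <= xi * C th by rewrite ler_pM2l.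
(* Here xi <= 2, since 2 * xi - 3 = K * K <= 1. The finish is below K * K * D1 + D1 + (2 - xi) * q
   l, and q l <= D1 turns this into xi * D1. *)
have : (2 - xi) * q l <= (2 - xi) * D1.
  apply: ler_wpM2l => //; have : K * K <= 1 by rewrite mulr_ile1// ltW.
  by rewrite xi_root; lra.
move: FA; rewrite (bigID (fun i => arr i < th))/=; have := B_arr_ge0 Bl; lra.
Qed.

End FastMachine.

(** * Competitiveness *)

Section Competitive.
Variables (R : realType) (xi : R) (tb : tie_rule R) (f : scheduler R).
Hypotheses (tbP : is_tie_rule tb) (fP : is_eve xi tb f).
Hypotheses (xi_gt1 : 1 < xi) (xi_ge : 1 + xi^-1 <= xi)
  (xi_root : xi^-1 * xi^-1 = 2 * xi - 3).

(* The tasks present at time t that the fast machine has not completed by then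
   occupy it at least as long in the schedule of the truncated instance, where
   none of them can start on a slow machine after t. *)
Lemma remaining_le_trunc T t i : is_tap T ->
  (forall j s, starts (f (trunc t T)) Fast j s ->
     s + fast_time (task_at (trunc t T) j) <= xi * copt (trunc t T)) ->
  starts (f T) Fast i (start_time (f T) i) ->
  arrival (task_at T i) <= t < start_time (f T) i ->
  t + \sum_(j <- fast_tasks T (f T) | (arrival (task_at T j) <= t) &&
         (t < start_time (f T) j + fast_time (task_at T j)))
       (start_time (f T) j + fast_time (task_at T j)
        - Num.max (start_time (f T) j) t) <= xi * copt (trunc t T).
Proof.
move=> tT IH si /andP[ait tsi].
have tT' := tap_trunc t tT; have eS := fP tT; have eS' := fP tT'.
set S := f T in eS si tsi *; set S' := f (trunc t T) in eS' IH.
have tr : trunc t T = trunc t (trunc t T) by rewrite trunc_trunc.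
set C := copt (trunc t T) in IH *.
pose st := start_time S; pose st' := start_time S'.
have sE u j m : u <= t -> starts S m j u <-> starts S' m j u.
  by move=> ut; apply: (starts_eq_trunc tbP m j tT tT' eS eS' tr ut).
(* The schedules agree up to [t]. A task started fast after [t] cannot go slow in the truncated
   instance: the optimum there stays [C], and already slow time + t exceeds xi * C. *)
have key j : starts S Fast j (st j) -> arrival (task_at T j) <= t ->
    [/\ (j < size (trunc t T))%N, starts S' Fast j (st' j),
        st j <= t -> st' j = st j & t < st j -> t < st' j].
  move=> sj ajt; have [jT _ _] := starts_pending tbP eS sj.
  have jT' : (j < size (trunc t T))%N by rewrite lt_size_trunc// jT.
  have [sjt|tsj] := leP (st j) t.
    have sj' := (sE _ j Fast sjt).1 sj.
    by rewrite /st' (start_timeE sj'); split.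
  have [m [s ss]] := eventually_starts tbP eS' jT'.
  have ts : t < s.
    rewrite ltNge; apply/negP => st0; have := (sE _ j m st0).2 ss.
    by move=> /(starts_time_uniq sj) e; move: tsj; rewrite e ltNge st0.
  case: m ss => [|k] ss; first by rewrite /st' (start_timeE ss); split.
  exfalso; case: (eS') => _ h _; have [_ _] := (h k j s).1 ss.
  move=> /(slow_okE xi s j tT'); rewrite task_at_trunc// trunc_id//; last first.
    move=> l lT'; apply: le_trans (ltW ts); rewrite task_at_trunc//.
    by move: lT'; rewrite lt_size_trunc// => /andP[].
  have := starts_fast_gt tbP tT eS sj (u := t).
  rewrite ajt ltW// => /(_ isT); rewrite -/C; lra.
pose A := [seq j <- fast_tasks T S | (arrival (task_at T j) <= t) &&
             (t < st j + fast_time (task_at T j))].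
have AP j : j \in A -> [/\ starts S Fast j (st j), arrival (task_at T j) <= t &
    t < st j + fast_time (task_at T j)].
  by rewrite mem_filter => /andP[/andP[ajt tj] /(fast_tasksP tbP eS) sj].
have fin j : j \in A -> st' j + fast_time (task_at T j) <= xi * C.
  move=> /AP[sj ajt _]; have [jT' sj' _ _] := key j sj ajt.
  by have := IH j _ sj'; rewrite task_at_trunc.
have fpos j : j \in A -> 0 < fast_time (task_at T j).
  by move=> /AP[/(starts_pending tbP eS)[jT _ _] _ _]; exact: (runtime_gt0 Fast tT jT).
have tC : t <= xi * C.
  have iA : i \in A.
    have [iT _ _] := starts_pending tbP eS si.
    rewrite mem_filter ait; apply/andP; split; last exact/(fast_tasksP tbP eS).
    by apply: lt_trans tsi _; rewrite ltrDl (runtime_gt0 Fast tT iT).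
  have [_ _ _ /(_ tsi)] := key i si ait; have := fin i iA; have := fpos i iA; lra.
pose E j := `[Num.max (st' j) t, st' j + fast_time (task_at T j)[%classic.
rewrite -/st -big_filter -/A.
have := @packing R A E t (xi * C) _ tC; move=> /(_ _ _ _)/wrap[].
- by rewrite !filter_uniq// iota_uniq.
- move=> j jA; split; first exact: measurable_itv.
  move=> u; rewrite /E /= !in_itv /= ge_max => /andP[/andP[_ ->]] /ltW/le_trans; apply.
  exact: fin.
- move=> j k u jA kA; rewrite /E /= !in_itv /= !ge_max.
  move=> /andP[/andP[ju _] uj] /andP[/andP[ku _] uk].
  have [sj ajt _] := AP j jA; have [jT' sj' _ _] := key j sj ajt.
  have [sk akt _] := AP k kA; have [kT' sk' _ _] := key k sk akt.
  have rj : runs S' Fast j u.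
    by apply: (starts_runs eS' sj' ju); rewrite /runtime task_at_trunc.
  have rk : runs S' Fast k u.
    by apply: (starts_runs eS' sk' ku); rewrite /runtime task_at_trunc.
  by move: rj; rewrite /runs /= rk => -[].
rewrite (eq_big_seq (fun j => (st j + fast_time (task_at T j) - Num.max (st j) t)%:E)).
  by rewrite sumEFin lee_fin; lra.
(* The clipped lengths agree: either the start times coincide, or both lie after [t] and the length
   is the full fast time. *)
move=> j jA; have [sj ajt tj] := AP j jA; have [jT' sj' e lt] := key j sj ajt.
have f0 := fpos j jA; rewrite /E lebesgue_measure_co.
  congr (_%:E); have [sjt|tsj] := leP (st j) t; first by rewrite e// max_r.
  by rewrite !max_l ?(ltW (lt _))// ?ltW//; lra.
rewrite ge_max lerDl (ltW f0) /=.
have [sjt|tsj] := leP (st j) t; first by rewrite e// ltW.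
by have := lt tsj; lra.
Qed.

(** Induction on the number of tasks: a truncation of smaller optimum has lost a task, which
    supplies [remaining_le]. *)
Lemma fast_finish T i s : is_tap T -> starts (f T) Fast i s ->
  s + fast_time (task_at T i) <= xi * copt T.
Proof.
elim: {T}(size T) {-2}T (leqnn (size T)) i s => [|n IH] T leT i s tT si.
  have [] := starts_pending tbP (fP tT) si; by move: leT; rewrite leqn0 => /eqP->.
have eS := fP tT.
rewrite -(start_timeE si).
have pend j : j \in fast_tasks T (f T) -> pending T (f T) (start_time (f T) j) j.
  by move=> /(fast_tasksP tbP eS) sj; exact: (starts_pending tbP eS sj).
apply: (@fast_completion R xi T (fast_tasks T (f T)) (start_time (f T))) => //.
- by rewrite filter_uniq// iota_uniq.
- by move=> j /pend[].
- by move=> j /pend[].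
- move=> j k /(fast_tasksP tbP eS) sj /(fast_tasksP tbP eS) sk /andP[jk kj].
  have rj : runs (f T) Fast j (start_time (f T) k) by exact: (starts_runs eS sj jk kj).
  by case: sk => + _; move: rj; rewrite /runs /= => -> [].
- by move=> j u /(fast_tasksP tbP eS) sj; exact: (starts_fast_gt tbP tT eS sj).
- move=> j u /(fast_tasksP tbP eS) sj au; have [k rk] := starts_fast_busy tbP tT eS sj au.
  by exists k; case: (runs_fast_tasks tbP eS rk).
- move=> j k /(fast_tasksP tbP eS) sj /(fast_tasksP tbP eS) sk.
  exact: (starts_fast_priority tbP tT eS sj sk).
- move=> t j ltC /(fast_tasksP tbP eS) sj atj; apply: (remaining_le_trunc tT _ sj atj).
  move=> k u sk; apply: IH => //; last exact: tap_trunc.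
  rewrite -ltnS; apply: leq_trans leT; rewrite ltnNge; apply/negP => h.
  by move: ltC; rewrite truncE// take_oversize// ltxx.
- by apply/(fast_tasksP tbP eS); rewrite (start_timeE si).
Qed.

Lemma eve_competitive : competitive xi f.
Proof.
move=> T tT; rewrite optE// -EFinM; have eS := fP tT.
apply: completion_le; first by rewrite mulr_ge0 ?copt_ge0// ltW// (lt_trans ltr01).
apply: (eve_finished tbP tT eS) => -[|k] i s ss; first exact: fast_finish.
exact: (slow_finish xi_gt1 tT eS ss).
Qed.

Lemma eve_committing : eventually_committing f.
Proof.
have on : online f.
  by move=> T T' t tT tT' e m s; exact: (eve_online tbP m tT tT' (fP tT) (fP tT') e).
split=> //; first by move=> T tT; exact: (eve_valid tbP tT (fP tT)).
move=> T T' t tT tT' e i m s st rs m' s'.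
have [_ _ u _] := eve_valid tbP tT' (fP tT') => /u; apply.
by move: rs; rewrite /runs /= (on T T' t tT tT' e m s st); exact.
Qed.

End Competitive.

(** * Existence of eve *)

Section Existence.
Variables (R : realType) (xi : R) (tb : tie_rule R) (T : seq (task R)).
Hypotheses (tbP : is_tie_rule tb) (tT : is_tap T).

Local Notation arr i := (arrival (task_at T i)).
Local Notation slo i := (slow_time (task_at T i)).
Local Notation fas i := (fast_time (task_at T i)).

(** Tasks run uninterrupted, so eve's schedule is determined by a machine and a start time per task;
    [None] means not started. The [map_] notions restate the rules on such data. *)
Definition start_map := nat -> option (machine * R).

Implicit Types (st : start_map).

Definition active_at st m i t := exists2 s, st i = Some (m, s) &
  s <= t < s + runtime m (task_at T i).

Definition map_schedule st : schedule R := fun m t =>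
  if pselect (exists i, active_at st m i t) is left h then Some (projT1 (cid h))
  else None.

Definition map_pending st t i :=
  [/\ (i < size T)%N, arr i <= t & forall m s, st i = Some (m, s) -> t <= s].

Definition map_waiting st t i := map_pending st t i /\ ~ slow_ok xi T t i.

Definition map_candidates st t : set nat :=
  [set i | map_waiting st t i /\
     forall j, map_waiting st t j -> slo j + arr j <= slo i + arr i].

Definition map_active st t j := exists s,
  [/\ st j = Some (Fast, s), s < t & t < s + fas j].

Definition starts_ok st t :=
  (forall k i, st i = Some (Slow k, t) <->
     [/\ k = i, map_pending st t i & slow_ok xi T t i]) /\
  (forall i, st i = Some (Fast, t) <->
     [/\ forall j, ~ map_active st t j, map_candidates st t !=set0 &
         i = tb (trunc t T) t (map_candidates st t)]).

Lemma tie_map_waiting st t : map_candidates st t !=set0 ->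
  map_waiting st t (tb (trunc t T) t (map_candidates st t)).
Proof. by move=> /(tbP (trunc t T) t)[]. Qed.

Lemma starts_ok_pending st m i t : starts_ok st t -> st i = Some (m, t) ->
  map_pending st t i.
Proof.
by case=> hs hf; case: m => [/hf[_ /tie_map_waiting[+ _] ->]|k /hs[]].
Qed.

Lemma map_candidates_neq0 st t i : map_waiting st t i -> map_candidates st t !=set0.
Proof.
move=> wi; have [|j cj] := @ex_max_candidate R T (map_waiting st t) i _ wi.
  by move=> j [[]].
by exists j.
Qed.

Lemma starts_ok_eve st : (forall t, starts_ok st t) ->
  eve_schedule xi tb T (map_schedule st).
Proof.
move=> ok.
have r0 m i s : st i = Some (m, s) -> s < s + runtime m (task_at T i).
  by move=> /(starts_ok_pending (ok s))[iT _ _]; rewrite ltrDl runtime_gt0.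
(* On the fast machine, the task that started first would still be active at the start of the
   other. *)
have disj m i j t : active_at st m i t -> active_at st m j t -> i = j.
  move=> [s ei /andP[st_ ts]] [s' ej /andP[st' ts']].
  case: m ei ej ts ts' => [|k] ei ej ts ts'; last first.
    by have [/(_ k i)[/(_ ei)[<- _ _] _] _] := ok s;
       have [/(_ k j)[/(_ ej)[<- _ _] _] _] := ok s'.
  have [_ /(_ i)[/(_ ei)[nai _ ie] _]] := ok s.
  have [_ /(_ j)[/(_ ej)[naj _ je] _]] := ok s'.
  case: (ltgtP s s') => [lt|lt|e].
  - by case: (naj i); exists s; split=> //; exact: le_lt_trans st' ts.
  - by case: (nai j); exists s'; split=> //; exact: le_lt_trans st_ ts'.
  - by rewrite ie je e.
have rE m i t : runs (map_schedule st) m i t <-> active_at st m i t.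
  rewrite /runs /map_schedule /=; case: pselect => [h|nh]; last first.
    by split=> // ai; case: nh; exists i.
  split=> [[<-]|ai]; first exact: (projT2 (cid h)).
  by congr Some; apply: disj ai; exact: (projT2 (cid h)).
have sE m i t : starts (map_schedule st) m i t <-> st i = Some (m, t).
  split=> [[/rE[s ei /andP[st_ ts]] nr]|ei].
    move: st_; rewrite le_eqVlt => /predU1P[<-//|st_].
    by case: (nr m s st_); apply/rE; exists s => //; rewrite lexx r0.
  split; first by apply/rE; exists t => //; rewrite lexx r0.
  move=> m' s st_ /rE[s']; rewrite ei => -[_ <-] /andP[].
  by rewrite leNgt st_.
have pE t i : pending T (map_schedule st) t i <-> map_pending st t i.
  split=> -[iT it nr]; split=> // m s.
    move=> ei; rewrite leNgt; apply/negP => st_; apply: (nr m s st_).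
    by apply/rE; exists s => //; rewrite lexx r0.
  by move=> st_ /rE[s' /nr ts' /andP[s's _]]; lra.
have wE t i : waiting xi T (map_schedule st) t i <-> map_waiting st t i.
  by split=> -[/pE pi nok].
have cE t : candidates xi T (map_schedule st) t = map_candidates st t.
  by apply/seteqP; split=> i [/wE wi mi]; split=> // j /wE; exact: mi.
have aE t j : still_active T (map_schedule st) t j <-> map_active st t j.
  by split=> -[s [/sE ss ? ?]]; exists s.
split.
- move=> m i t; split=> [/rE[s ei h]|[s /sE ei h]]; first by exists s => //; apply/sE.
  by apply/rE; exists s.
- move=> k i t; have [h _] := ok t; split=> [/sE/h[-> /pE]//|[ki /pE p s]].
  by apply/sE/h.
- move=> i t; have [_ h] := ok t; rewrite cE; split=> [/sE/h[na cn ie]|[na cn ie]].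
    by split=> // j /aE; exact: na.
  by apply/sE/h; split=> // j /aE; exact: na.
Qed.

(** The state of the construction: eve's run up to [u], with nothing decided afterwards. *)
Definition map_invariant st u := (forall t, t <= u -> starts_ok st t) /\
  (forall i m s, st i = Some (m, s) -> s <= u).

Definition must_start st t := exists2 i, map_pending st t i &
  slow_ok xi T t i \/ forall j, ~ map_active st t j.

Lemma starts_ok_idle st u t : map_invariant st u -> u < t ->
  ~ must_start st t -> starts_ok st t.
Proof.
move=> [_ le_u] ut nm; have none m i : st i <> Some (m, t).
  by move=> /le_u; rewrite leNgt ut.
split=> [k i|i]; split=> [/none//|]; first by move=> [_ pi ok]; case: nm; exists i; [|left].
by move=> [na /tie_map_waiting[p _] _]; case: nm; eexists; [exact: p|right].
Qed.

(* Between two events the truncation and the active task do not change, and waiting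
   only makes a slow start harder. *)
Lemma must_start_event st u t : map_invariant st u -> u < t -> must_start st t ->
  exists2 e, u < e <= t & must_start st e /\
    e \in [seq arr i | i <- iota 0 (size T)] ++
          [seq (if st i is Some (m, s) then s + fas i else 0) | i <- iota 0 (size T)].
Proof.
move=> [ok le_u] ut [i [iT it pi] hi]; set E := _ ++ _.
have iN : st i = None.
  by case e: (st i) => [[m s]|//]; have := pi _ _ e; rewrite leNgt (le_lt_trans (le_u _ _ _ e)).
have iE : arr i \in E by rewrite mem_cat map_f// mem_iota.
(* [e] is the last event up to [t], an arrival or a completion; unstarted tasks contribute a dummy 0
   to [E]. *)
have [|e [eE et maxe]] := @ex_argmax R _ E id (fun e => e <= t); first by exists (arr i).
have ie : arr i <= e by exact: maxe.
have finE j s : st j = Some (Fast, s) -> (j < size T)%N /\ s + fas j \in E.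
  move=> ej; have [jT _ _] := starts_ok_pending (ok s (le_u _ _ _ ej)) ej.
  split=> //; rewrite mem_cat; apply/orP; right; apply/mapP; exists j; rewrite ?mem_iota//.
  by rewrite ej.
have pend w : e <= w -> map_pending st w i.
  by move=> ew; split=> //; [exact: le_trans ew|rewrite iN].
have tr w : e <= w <= t -> trunc w T = trunc t T.
  move=> /andP[ew wt]; rewrite -(trunc_trunc T wt) trunc_id//; first exact: tap_trunc.
  move=> j jT; rewrite task_at_trunc//; move: jT; rewrite lt_size_trunc// => /andP[jT jt].
  by apply: le_trans ew; apply: maxe => //; rewrite mem_cat map_f// mem_iota.
have slow w : e <= w <= t -> slow_ok xi T t i -> slow_ok xi T w i.
  move=> /[dup] ewt /andP[ew wt] /(slow_okE xi t i tT) h.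
  apply/(slow_okE xi w i tT); rewrite (tr _ ewt); apply: le_trans h.
  by rewrite lerD2l.
have act w j : e <= w <= t -> map_active st w j -> map_active st t j.
  move=> /andP[ew wt] [s [ej sw ws]]; exists s; split=> //; first exact: lt_le_trans wt.
  rewrite ltNge; apply/negP => h; have [_ fE] := finE _ _ ej; have := maxe _ fE h; lra.
have [eu|ue] := leP e u; last first.
  exists e; first by rewrite ue.
  split=> //; exists i; first exact: pend.
  have ewt : e <= e <= t by rewrite lexx.
  by case: hi => [/(slow _ ewt)|na]; [left|right=> j /(act _ _ ewt)/na].
(* With no event after [u], the rules at [u] would already have started [i] slow, or a fast task
   that is still active at [t]. *)
exfalso; have ewt : e <= u <= t by rewrite eu ltW.
have [hs hf] := ok u (lexx u).
have nslow : ~ slow_ok xi T u i.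
  by move=> h; have := (hs i i).2 (And3 erefl (pend u eu) h); rewrite iN.
case: hi => [/(slow _ ewt)//|na].
have cn : map_candidates st u !=set0
  by apply: (@map_candidates_neq0 _ _ i); split=> //; exact: pend.
have nau j : ~ map_active st u j by move=> /(act _ _ ewt)/na.
have ej := (hf _).2 (And3 nau cn erefl); set j := tb _ _ _ in ej.
have [jT fE] := finE _ _ ej; apply: (na j); exists u; split=> //.
rewrite ltNge; apply/negP => h; have := maxe _ fE h; have := runtime_gt0 Fast tT jT => /=; lra.
Qed.

Lemma first_must_start st u : map_invariant st u -> ~ (forall t, starts_ok st t) ->
  exists v, [/\ u < v, must_start st v & forall t, t < v -> starts_ok st t].
Proof.
move=> inv; have ok := inv.1; move=> /existsNP[t nok].
have ut : u < t by rewrite ltNge; apply/negP => /ok.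
have mt : must_start st t by apply: contrapT => /(starts_ok_idle inv ut).
have [e /andP[ue et] [me eE]] := must_start_event inv ut mt.
move: eE; set E := _ ++ _ => eE.
have [|v [vE [uv mv] minv]] := @ex_argmin R _ E id (fun e => u < e /\ must_start st e).
  by exists e.
exists v; split=> // s sv; have [su|us] := leP s u; first exact: ok.
apply: (starts_ok_idle inv us) => ms.
have [e' /andP[ue' e's] [me' e'E]] := must_start_event inv us ms.
by have := minv e' e'E (conj ue' me'); rewrite leNgt (le_lt_trans e's sv).
Qed.

Definition extend_map st v : start_map := fun i =>
  if st i is Some x then Some x
  else if `[< map_pending st v i /\ slow_ok xi T v i >] then Some (Slow i, v)
  else if `[< [/\ forall j, ~ map_active st v j, map_candidates st v !=set0 &
      i = tb (trunc v T) v (map_candidates st v)] >] then Some (Fast, v)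
  else None.

(** Starts made at [v] leave the pending, waiting and active tasks at times up to [v] unchanged, so
    no rule is disturbed. *)
Lemma extend_map_invariant st u v : map_invariant st u -> u < v ->
  (forall t, t < v -> starts_ok st t) -> map_invariant (extend_map st v) v.
Proof.
move=> [_ le_u] uv ok; set st' := extend_map st v.
have old i x : st i = Some x -> st' i = Some x by rewrite /st' /extend_map => ->.
have new i m s : st' i = Some (m, s) -> st i = Some (m, s) \/ s = v.
  rewrite /st' /extend_map; case: (st i) => [x|]; first by left.
  by case: ifP => _; [case=> _ <-; right|case: ifP => // _ [_ <-]; right].
have none i m s : map_pending st v i -> st i <> Some (m, s).
  by move=> [_ _ h] e; have := h _ _ e; rewrite leNgt (le_lt_trans (le_u _ _ _ e)).
have le_v i m s : st' i = Some (m, s) -> s <= v.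
  by move=> /new[/le_u/le_trans|->//]; apply; exact: ltW.
split=> // t tv.
have pE i : map_pending st' t i <-> map_pending st t i.
  split=> -[iT it h]; split=> // m s.
    by move=> /old; exact: h.
  by move=> /new[|->//]; exact: h.
have wE i : map_waiting st' t i <-> map_waiting st t i by split=> -[/pE].
have cE : map_candidates st' t = map_candidates st t.
  by apply/seteqP; split=> i [/wE wi mi]; split=> // j /wE; exact: mi.
have aE j : map_active st' t j <-> map_active st t j.
  split=> -[s [ej s_t ts]]; exists s; split=> //; last exact: old.
  by case/new: ej => // sv; move: s_t; rewrite sv ltNge tv.
move: tv; rewrite le_eqVlt => /predU1P[tv|tv]; last first.
  have eE i m : st' i = Some (m, t) <-> st i = Some (m, t).
    by split=> [/new[//|tv']|/old//]; move: tv; rewrite tv' ltxx.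
  have [hs hf] := ok t tv; rewrite /starts_ok cE; split=> [k i|i].
    split=> [/eE/hs[-> /pE]//|[ki /pE p s]]; exact/eE/hs.
  split=> [/eE/hf[na cn ie]|[na cn ie]]; first by split=> // j /aE; exact: na.
  by apply/eE/hf; split=> // j /aE; exact: na.
subst t; rewrite /starts_ok cE; split=> [k i|i].
  split=> [|[-> /pE p s]].
    rewrite /st' /extend_map; case e: (st i) => [[m s]|].
      by move=> [_ sv]; have := le_u _ _ _ e; rewrite sv leNgt uv.
    case: ifPn => [/asboolP[p s] [<-]|_]; first by split=> //; exact/pE.
    by case: ifPn.
  rewrite /st' /extend_map; case e: (st i) => [[m s']|]; first by case: (none _ _ _ p e).
  by rewrite asboolT.
split=> [|[na cn ie]].
  rewrite /st' /extend_map; case e: (st i) => [[m s]|].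
    by move=> [_ sv]; have := le_u _ _ _ e; rewrite sv leNgt uv.
  case: ifPn => // _; case: ifPn => // /asboolP[na cn ie] _.
  by split=> // j /aE; exact: na.
have [p nok] := tie_map_waiting cn; rewrite -ie in p nok.
rewrite /st' /extend_map; case e: (st i) => [[m s']|]; first by case: (none _ _ _ p e).
rewrite asboolF; last by case.
by rewrite asboolT//; split=> // j /aE; exact: na.
Qed.

Lemma extend_map_new st u v : map_invariant st u -> u < v -> must_start st v ->
  exists i, [/\ (i < size T)%N, st i = None & extend_map st v i].
Proof.
move=> [_ le_u] uv [i pi hi].
have none j : map_pending st v j -> st j = None.
  move=> [_ _ h]; case e: (st j) => [[m s]|//].
  by have := h _ _ e; rewrite leNgt (le_lt_trans (le_u _ _ _ e)).
have [ok|nok] := pselect (slow_ok xi T v i).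
  exists i; split; [by case: pi|exact: none|].
  by rewrite /extend_map none// asboolT.
case: hi => // na; have cn := map_candidates_neq0 (conj pi nok).
have [p nok'] := tie_map_waiting cn; set j := tb _ _ _ in p nok'.
exists j; split; [by case: p|exact: none|].
rewrite /extend_map none// asboolF; last by case.
by rewrite asboolT.
Qed.

(** Each extension starts a new task, so the number of unstarted tasks decreases. *)
Lemma exists_starts_ok st u : map_invariant st u -> exists st', forall t, starts_ok st' t.
Proof.
pose N st := #|[pred i : 'I_(size T) | ~~ isSome (st i)]|.
elim: {st}(N st).+1 {-2}st (ltnSn (N st)) u => [|n IH] st // stn u inv.
have [|nok] := pselect (forall t, starts_ok st t); first by exists st.
have [v [uv mv ok]] := first_must_start inv nok.
apply: (IH (extend_map st v) _ v); last exact: (extend_map_invariant inv uv ok).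
rewrite ltnS in stn; apply: leq_trans stn; apply: proper_card; apply/properP; split.
  by apply/fintype.subsetP => i; rewrite !inE /extend_map; case: (st i).
have [i [iT iN iS]] := extend_map_new inv uv mv.
by exists (Ordinal iT); rewrite !inE /= ?iN ?negbK.
Qed.

Lemma exists_eve_schedule : exists S, eve_schedule xi tb T S.
Proof.
(* The construction begins at time -1, before any arrival. *)
have [|st ok] := @exists_starts_ok (fun _ => None) (-1); last first.
  by exists (map_schedule st); exact: starts_ok_eve.
split=> // t t1; have np i : ~ map_pending (fun _ => None) t i.
  by case=> iT it _; case: tT => _ /(_ i iT)[_ _]; lra.
split=> [k i|i]; split=> //; first by case=> _ /np.
by case=> _ /tie_map_waiting[/np].
Qed.

End Existence.

Lemma exists_eve (R : realType) (xi : R) (tb : tie_rule R) :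
  is_tie_rule tb -> exists f : scheduler R, is_eve xi tb f.
Proof.
move=> tbP; exists (fun T =>
  if pselect (is_tap T) is left tT then projT1 (cid (exists_eve_schedule xi tbP tT))
  else fun _ _ => None).
move=> T tT; case: pselect => // tT'.
exact: (projT2 (cid (exists_eve_schedule xi tbP tT'))).
Qed.

Theorem theorem4p1 (R : realType) :
  exists xi : R,
    [/\ root (2%:P * 'X^3 - 3%:P * 'X^2 - 1 : {poly R}) xi,
        forall x : R, root (2%:P * 'X^3 - 3%:P * 'X^2 - 1 : {poly R}) x ->
          x = xi,
        `|xi - 1678 / 1000| < 1 / 2000 &
        forall tb : tie_rule R, is_tie_rule tb ->
          (exists f : scheduler R, is_eve xi tb f) /\
          forall f : scheduler R, is_eve xi tb f ->
            eventually_committing f /\ competitive xi f].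
Proof.
have [xi rxi /andP[lo up]] := exists_root R; exists xi; split=> //.
- by move=> x rx; apply: root_uniq; exact: root_pE.
- by rewrite ltr_norml; apply/andP; split; lra.
have h := root_pE rxi; have xi0 : 0 < xi by lra.
have xi1 : 1 < xi by lra.
have xi_root := root_inv_sqr h.
have xi_ge : 1 + xi^-1 <= xi.
  rewrite -(ler_pM2l xi0) mulrDr mulr1 divff ?gt_eqF//.
  (* This gives xi ^ 2 >= 1.677 * xi, and 0.677 * xi > 1 makes the goal xi + 1 <= xi * xi linear. *)
  have : 0 <= (xi - 1677 / 1000) * xi by apply: mulr_ge0; lra.
  by lra.
move=> tb tbP; split; first exact: exists_eve.
by move=> f fP; split; [exact: (eve_committing tbP fP)|exact: (eve_competitive tbP fP)].
Qed.
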